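(* Let $\vec a=(a_0,\dots,a_n)\in\mathbb{Z}^{n+1}$ be an integer vector with amplitude $M:=\max_{0\le i\le n} a_i-\min_{0\le i\le n} a_i$, let $H:=H_{\vec a}$ be its tropical entropy and $d:=d_{\vec a}$ its tropical Hilbert function. Then the tropical Hilbert function $$d(k)=Hk+r(k)$$ is quasi-linear for $k>(Mn)^{O(n)}$, where $r(k)$ is a periodic function with an integer period less than $\exp((O(Mn))^n)$.
   Context: A sequence $(z_1,\dots,z_k)\in\mathbb{R}^k$ satisfies $\vec a$ if for every $1\le j\le k-n$ the minimum $\min_{0\le i\le n}\{z_{j+i}+a_i\}$ is attained for at least two different values of $i$. $D(k)\subset\mathbb{R}^k$ denotes the set of all such sequences; it is a finite union of polyhedra. The tropical Hilbert function is $d_{\vec a}(k):=\dim D(k)$ (the maximal dimension of a polyhedron in this union). The tropical entropy is $H_{\vec a}:=\lim_{k\to\infty}d_{\vec a}(k)/k$ (the limit exists by subadditivity of $d_{\vec a}$). A function from the natural numbers to themselves is called quasi-linear if it is a sum of a linear function and a periodic function with an integer period.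
   Formalization: The formal statement takes n ≥ 1 (for n = 0 the set D(k) is empty) and replaces M by max(M,1) in both bounds, since for a constant vector (M = 0) no integer period is less than exp(0) = 1. *)

(* Defs.v *)
From mathcomp Require Import all_boot all_order all_algebra.
From mathcomp Require Import all_classical all_reals all_analysis.

Set Implicit Arguments.
Unset Strict Implicit.
Unset Printing Implicit Defensive.

Import Order.TTheory GRing.Theory Num.Theory numFieldNormedType.Exports.

Local Open Scope classical_set_scope.
Local Open Scope ring_scope.

Section PolyhedralDimension.
Variables (R : realType) (k : nat).
Implicit Types P S : set 'rV[R]_k.

Definition polyhedron P : Prop :=
  exists (m : nat) (A : 'M[R]_(k, m)) (b : 'rV[R]_m),
    P = [set x | forall i, (x *m A) 0 i <= b 0 i].

(* [x] together with the [x + row i B], [i < m], are [m.+1] affinely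
   independent points of [P]. *)
Definition has_aff_indep P (m : nat) : Prop :=
  exists (x : 'rV[R]_k) (B : 'M[R]_(m, k)),
    [/\ x \in P, forall i, x + row i B \in P & row_free B].

(* The dimension of the affine hull; the empty set gets the junk value 0. *)
Definition aff_dim P : nat := \max_(m < k.+1 | `[< has_aff_indep P m >]) m.

(* The maximal dimension of a polyhedron in [S].  When [S] is a finite union of
   polyhedra, this is the maximal dimension of a member of the union, whatever
   the decomposition of [S]. *)
Definition polyhedral_dim S : nat :=
  \max_(m < k.+1 | `[< exists P, [/\ polyhedron P, P `<=` S & aff_dim P = m] >])
     m.

End PolyhedralDimension.

Lemma window_subproof (n k : nat) (j : 'I_(k - n)) (i : 'I_n.+1) :
  (j + i < k)%N.
Proof.
have := ltn_ord j; rewrite ltn_subRL addnC; apply: leq_ltn_trans.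
by rewrite leq_add2l -ltnS.
Qed.

(* Indices start at 0: the windows are [j, ..., j + n] for [j < k - n], and
   there is none when [k <= n]. *)
Definition window (n k : nat) (j : 'I_(k - n)) (i : 'I_n.+1) : 'I_k :=
  Ordinal (window_subproof j i).

Section TropicalRecurrence.
Variables (R : realType) (n : nat) (a : 'rV[R]_n.+1).

Definition min_attained_twice (f : 'I_n.+1 -> R) : Prop :=
  exists i1 i2, [/\ i1 != i2, forall i, f i1 <= f i & forall i, f i2 <= f i].

Definition trop_sols (k : nat) : set 'rV[R]_k :=
  [set z | forall j : 'I_(k - n),
     min_attained_twice (fun i => z 0 (window j i) + a 0 i)].

Definition trop_hilbert (k : nat) : nat := polyhedral_dim (@trop_sols k).

Definition trop_entropy : R :=
  limn (fun k => (trop_hilbert k)%:R / k%:R : R).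

End TropicalRecurrence.

Arguments trop_sols {R n} a k _.

(* The difference is nonnegative, so the absolute value only casts to [nat]. *)
Definition amplitude (n : nat) (a : 'rV[int]_n.+1) : nat :=
  absz (\big[Num.max/a 0 ord0]_i a 0 i - \big[Num.min/a 0 ord0]_i a 0 i)%R.

(* Main.v *)
(* Since [a] is integral, entries of a solution tied in a window are congruent
   modulo 1.  Moving each class modulo 1 independently shows that [d k] is the
   largest number of classes modulo 1 met by a solution of length [k].
   Subtracting integers from entries too large ever to attain a minimum, one
   may assume that [n] consecutive entries differ by at most [5 n M].  The
   order type of such a block (all comparisons of its differences with
   integers) takes at most [(22 n^2 M)^n] values, and it decides how the
   sequence can be continued and whether the next entry can open a new class.
   So [d] is the maximal weight of walks of given length in a finite graph with
   weights 0 and 1.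

   In such a graph let [A / B] be the best ratio weight/length of closed walks.
   A long optimal walk meets a vertex lying on a closed walk of that ratio.
   From there it can be diverted to one of a maximal family of disjoint optimal
   cycles, of length [q] say; cutting out closed walks of length divisible by
   [q] and turning around that cycle changes its length by any multiple of [q]
   without loss.  The lengths [q] have sum at most the number [N] of vertices,
   so with [N <= X^2] at most [X] of them exceed [X], and [X!] times the
   product of those is a common multiple which is at most [X^(3 X)]. *)

Require Import Defs.
From mathcomp Require Import all_boot all_order all_algebra.
From mathcomp Require Import all_classical all_reals all_analysis.
From mathcomp Require Import zify ring lra.

Set Implicit Arguments.
Unset Strict Implicit.
Unset Printing Implicit Defensive.

Import Order.TTheory GRing.Theory Num.Theory numFieldNormedType.Exports.

Local Open Scope ring_scope.

(** * Optimal walks in finite graphs *)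

Section Walks.
Variables (T : finType) (e : rel T) (w : T -> T -> bool).
Implicit Types (x y : T) (s : seq T).

Fixpoint weight x s : nat :=
  if s is y :: s' then (w x y + weight y s')%N else 0%N.

Lemma weight_cat x s1 s2 :
  weight x (s1 ++ s2) = (weight x s1 + weight (last x s1) s2)%N.
Proof. by elim: s1 x => //= y s1 IH x; rewrite IH addnA. Qed.

Lemma weight_le_size x s : (weight x s <= size s)%N.
Proof.
by elim: s x => //= y s IH x; have := IH y; case: (w x y) => /=; lia.
Qed.

Definition walk x s y := path e x s && (last x s == y).

Lemma walk_cat x s1 s2 y :
  walk x (s1 ++ s2) y = walk x s1 (last x s1) && walk (last x s1) s2 y.
Proof. by rewrite /walk cat_path last_cat eqxx andbT andbA. Qed.

Lemma walk_trans y x s1 s2 z :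
  walk x s1 y -> walk y s2 z -> walk x (s1 ++ s2) z.
Proof.
by move=> /andP[p1 /eqP e1] h2; rewrite walk_cat /walk e1 p1 eqxx.
Qed.

Lemma weight_walk_cat y x s1 s2 :
  walk x s1 y -> weight x (s1 ++ s2) = (weight x s1 + weight y s2)%N.
Proof. by case/andP=> _ /eqP <-; rewrite weight_cat. Qed.

Lemma walk_last x s y : walk x s y -> last x s = y.
Proof. by case/andP=> _ /eqP. Qed.

Lemma walk_split x s y i j : walk x s y -> (i <= j <= size s)%N ->
  nth x (x :: s) i = nth x (x :: s) j ->
  exists s1 s2 s3 z, [/\ s = s1 ++ s2 ++ s3, size s1 = i, size s2 = (j - i)%N,
    walk x s1 z & walk z s2 z /\ walk z s3 y].
Proof.
move=> xsy /andP[ij js] hn.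
pose s1 := take i s; pose s2 := take (j - i) (drop i s); pose s3 := drop j s.
have s12 : s1 ++ s2 = take j s by rewrite -takeD subnKC.
have es : s = s1 ++ s2 ++ s3 by rewrite catA s12 cat_take_drop.
have nthE (l : nat) : (l <= size s)%N -> last x (take l s) = nth x (x :: s) l.
  case: l => [|l] ll; first by rewrite take0.
  by rewrite -nth_last size_takel //= nth_take // (set_nth_default x).
have z2 : last (last x s1) s2 = last x s1.
  by rewrite -last_cat s12 !nthE // (leq_trans ij).
exists s1, s2, s3, (last x s1); split=> //.
- by rewrite size_takel // (leq_trans ij).
- by rewrite size_takel // size_drop leq_sub2r.
- by move: xsy; rewrite es walk_cat => /andP[].
- by move: xsy; rewrite es !walk_cat z2 => /andP[_ /andP[-> ->]].
Qed.

(* Pigeonhole on the pairs (vertex, time modulo c). *)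
Lemma walk_cut c x s y : (0 < c)%N -> walk x s y -> (#|T| * c <= size s)%N ->
  exists s1 s2 s3 z, [/\ s = s1 ++ s2 ++ s3, (0 < size s2 <= #|T| * c)%N,
    (c %| size s2)%N, walk x s1 z & walk z s2 z /\ walk z s3 y].
Proof.
move=> c0 xsy les.
pose h (i : 'I_(#|T| * c).+1) : T * 'I_c :=
  (nth x (x :: s) i, Ordinal (ltn_pmod i c0)).
have /injectivePn[i0 [j0 ij0 hij0]] : ~~ injectiveb h.
  apply/negP => /injectiveP /leq_card; rewrite card_prod !card_ord; lia.
have [i [j [ij [hn hm]]]] :
    exists i j : 'I_(#|T| * c).+1, (i < j)%N /\ h i = h j.
  case: (ltngtP i0 j0) => h0; [by exists i0, j0|by exists j0, i0|].
  by move: ij0; rewrite (ord_inj h0) eqxx.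
have ijs : (i <= j <= size s)%N by have := ltn_ord j; lia.
have [s1 [s2 [s3 [z [es ss1 ss2 w1 w23]]]]] := walk_split xsy ijs hn.
exists s1, s2, s3, z; split=> //; rewrite ss2.
- by have := ltn_ord j; lia.
- by rewrite -eqn_mod_dvd ?(ltnW ij) // hm.
Qed.

(** Closed walks of length at most [#|T|] realize finitely many pairs (weight, length), so one ratio
    is largest. A longer closed walk splits into two shorter closed ones, and adding their
    inequalities gives its own. *)
Lemma ratio_max (x0 : T) s0 : (0 < size s0 <= #|T|)%N -> walk x0 s0 x0 ->
  exists x s, [/\ (0 < size s <= #|T|)%N, walk x s x &
    forall y s', walk y s' y ->
      (weight y s' * size s <= weight x s * size s')%N].
Proof.
move=> sz0 w0; set N := #|T|.
pose P (q : 'I_N.+1 * 'I_N.+1) := `[< exists x s, [/\ (0 < size s <= N)%N,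
  walk x s x, weight x s = q.1 & size s = q.2] >].
have PI x s : (0 < size s <= N)%N -> walk x s x ->
    P (inord (weight x s), inord (size s)).
  move=> sz wx; apply/asboolP; exists x, s; have := weight_le_size x s.
  by move=> h; split=> //; rewrite inordK //; lia.
pose F (q : 'I_N.+1 * 'I_N.+1) : rat := (q.1)%:R / (q.2)%:R.
have FE x s : (0 < size s <= N)%N ->
    F (inord (weight x s), inord (size s)) = (weight x s)%:R / (size s)%:R.
  by move=> sz; rewrite /F /= !inordK //; have := weight_le_size x s; lia.
have Pq0 := PI _ _ sz0 w0.
have [q /asboolP[x [s [sz wx e1 e2]]] qmax] := arg_maxP F Pq0.
exists x, s; split=> // y s'.
have [m] := ubnP (size s'); elim: m y s' => // m IH y s' sm ws'.
have [s'0|s'0] := posnP (size s'); first by rewrite (size0nil s'0).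
have [le|lt] := leqP (size s') N.
  have {}le : (0 < size s' <= N)%N by rewrite s'0.
  have := qmax _ (PI _ _ le ws'); rewrite FE // /F -e1 -e2.
  case/andP: sz => sz _.
  move=> /= h; move: h.
  rewrite ler_pdivrMr ?ltr0n // mulrAC ler_pdivlMr ?ltr0n //.
  by rewrite -!natrM ler_nat.
have [|s1 [s2 [s3 [z [es s2n _ w1 [w2 w3]]]]]] := walk_cut (c := 1) isT ws'.
  by rewrite muln1 ltnW.
rewrite muln1 in s2n.
have := IH z s2 _ w2; have := IH y (s1 ++ s3) _ (walk_trans w1 w3).
move: sm lt.
rewrite es !size_cat !(weight_walk_cat _ w1) (weight_walk_cat _ w2).
move=> sm lt /(_ _)/wrap[]; first lia.
move=> h /(_ _)/wrap[]; first lia.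
by move: h; rewrite !mulnDl !mulnDr; lia.
Qed.

(** * Loss against the best ratio, and loops without loss *)

Section Defect.
Variables A B : nat.

(** [B] times the weight lost against the rate [A / B]. When [A / B] is the best ratio, it is
    nonnegative on closed walks and zero on the optimal ones. *)
Definition defect x s : int := A%:Z * (size s)%:Z - B%:Z * (weight x s)%:Z.

Lemma defect_cat y x s1 s2 :
  walk x s1 y -> defect x (s1 ++ s2) = defect x s1 + defect y s2.
Proof. by move=> w1; rewrite /defect (weight_walk_cat _ w1) size_cat; lia. Qed.

Definition loops m s : seq T := flatten (nseq m s).

Lemma size_loops m s : size (loops m s) = (m * size s)%N.
Proof.
by elim: m => // m IH; rewrite /loops /= size_cat -/(loops m s) IH mulSn.
Qed.

Lemma walk_loops m x s : walk x s x -> walk x (loops m s) x.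
Proof.
move=> ws; elim: m => [|m IH]; first by rewrite /walk /= eqxx.
exact: walk_trans ws IH.
Qed.

Lemma defect_loops m x s :
  walk x s x -> defect x (loops m s) = m%:Z * defect x s.
Proof.
move=> ws; elim: m => [|m IH]; first by rewrite /defect /=; lia.
by rewrite /loops /= (defect_cat _ ws) -/(loops m s) IH; lia.
Qed.

Hypothesis defect_ge0 : forall x s, walk x s x -> 0 <= defect x s.

(** Closed pieces of length divisible by [c] are cut out while the walk is long; each has
    nonnegative defect, so the defect cannot grow. *)
Lemma walk_reduce c x s y : (0 < c)%N -> walk x s y ->
  exists s', [/\ walk x s' y, (size s' < #|T| * c)%N,
    size s' = size s %[mod c] & defect x s' <= defect x s].
Proof.
move=> c0; have [m] := ubnP (size s); elim: m s => // m IH s sm ws.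
have [lt|le] := ltnP (size s) (#|T| * c); first by exists s.
have [s1 [s2 [s3 [z [es s2n cs2 w1 [w2 w3]]]]]] := walk_cut c0 ws le.
have [|s' [ws' ls' ms' ds']] := IH (s1 ++ s3) _ (walk_trans w1 w3).
  by move: sm; rewrite es !size_cat; lia.
exists s'; split=> //.
  rewrite ms' es !size_cat addnCA -[in RHS]modnDml.
  by rewrite (eqP cs2).
apply: le_trans ds' _; rewrite es !(defect_cat _ w1) (defect_cat _ w2).
by have := defect_ge0 w2; lia.
Qed.

Definition critical_loop x s :=
  [/\ (0 < size s)%N, walk x s x & defect x s = 0].

Definition critical x := exists s, critical_loop x s.

(** Away from critical vertices every closed piece cut out has integer defect at least 1 and at most
    [#|T|] edges. The short walk that remains has defect at least [- B * #|T|], so length is bounded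
    linearly by defect. *)
Lemma noncritical_defect x s y : (forall v, v \in x :: s -> ~ critical v) ->
  walk x s y ->
  (size s)%:Z <= #|T|%:Z * (defect x s + B%:Z * #|T|%:Z) + #|T|%:Z.
Proof.
have [m] := ubnP (size s); elim: m s => // m IH s sm nc ws.
have [lt|le] := ltnP (size s) #|T|.
  have h : - (B%:Z * #|T|%:Z) <= defect x s.
    rewrite /defect; have := weight_le_size x s.
    move: (weight x s) (size s) lt => W S h1 h2; nia.
  nia.
have [|s1 [s2 [s3 [z [es s2n _ w1 [w2 w3]]]]]] := walk_cut (c := 1) isT ws.
  by rewrite muln1.
rewrite muln1 in s2n.
have dz : 1 <= defect z s2.
  have := defect_ge0 w2; rewrite le_eqVlt => /predU1P[d0|]; last by lia.
  case: (nc z); last by exists s2; split=> //; case/andP: s2n.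
  by rewrite -(walk_last w1) es -cat_cons mem_cat mem_last.
have := IH (s1 ++ s3) _ _ (walk_trans w1 w3).
move: sm nc; rewrite es !(defect_cat _ w1) (defect_cat _ w2) !size_cat => sm nc.
move=> /(_ _)/wrap[]; first lia.
move=> /(_ _)/wrap[].
  move=> v vs; apply: nc; move: vs; rewrite !inE !mem_cat.
  by case/or3P=> ->; rewrite ?orbT.
nia.
Qed.

(** Greedy choice: take a shortest critical loop in [X], delete its vertices and recurse. The loops
    are simple and disjoint, which bounds their total length; a critical loop avoiding the first one
    survives in the rest. *)
Lemma critical_loop_family (X : {set T}) : exists Cs : seq (T * seq T),
  [/\ {in Cs, forall C, critical_loop C.1 C.2},
    (\sum_(C <- Cs) size C.2 <= #|X|)%N &
    forall x s, critical_loop x s -> {subset s <= X} ->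
      exists2 C, C \in Cs & has [in C.2] s].
Proof.
have [m] := ubnP #|X|; elim: m X => // m IH X Xm.
pose P l :=
  `[< exists x s, [/\ size s = l, critical_loop x s & {subset s <= X}] >].
have [exP|none] := pselect (exists l, P l); last first.
  exists [::]; split; rewrite ?big_nil // => x s cs sX.
  by case: none; exists (size s); apply/asboolP; exists x, s.
case: (ex_minnP exP) => _ /asboolP[x [s [<- [s0 ws ds] sX]]] smin.
(* A repeated vertex splits the loop into two closed walks with nonnegative defects of sum zero; the
   inner one would be a shorter critical loop. *)
have us : uniq s.
  apply/negPn/negP => /(uniqPn x)[i [j [ij js hn]]].
  have [|s1 [s2 [s3 [z [es ss1 ss2 w1 [w2 w3]]]]]] :=
    walk_split (i := i.+1) (j := j.+1) ws _ hn.
    by rewrite js andbT ltnS ltnW.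
  have d2 := defect_ge0 w2; have d13 := defect_ge0 (walk_trans w1 w3).
  move: ds; rewrite es (defect_cat _ w1) (defect_cat _ w2).
  rewrite (defect_cat _ w1) in d13 => ds.
  have /smin : P (size s2).
    apply/asboolP; exists z, s2; split=> //; first by split=> //; lia.
    by move=> v vs; apply: sX; rewrite es !mem_cat vs orbT.
  by rewrite ss2 subSS => /(leq_trans js); rewrite ltnNge leq_subr.
have sXs : [set v in s] \subset X.
  by apply/fintype.subsetP => v; rewrite inE => /sX.
have cs : #|[set v in s]| = size s by rewrite cardsE; apply/card_uniqP.
have [|Cs [Cc Csz Ch]] := IH (X :\: [set v in s]).
  by rewrite cardsDS // cs; have := subset_leq_card sXs; rewrite cs; lia.
exists ((x, s) :: Cs); split.
- by move=> C; rewrite inE => /predU1P[->|/Cc].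
- rewrite big_cons /=; move: Csz; rewrite cardsDS // cs.
  by have := subset_leq_card sXs; rewrite cs; lia.
- move=> y t ct tX; have [h|nh] := boolP (has [in s] t).
    by exists (x, s); rewrite ?mem_head.
  have [|C CC hC] := Ch y t ct; last by exists C; rewrite ?inE ?CC ?orbT.
  move=> v vt; rewrite !inE tX // andbT; apply: contra nh => vs.
  by apply/hasP; exists v.
Qed.

Lemma critical_loop_rot x s y : critical_loop x s -> y \in s ->
  exists2 s', critical_loop y s' & size s' = size s.
Proof.
move=> [s0 ws ds] /path.splitP ys; case: _ / ys ws ds s0 => s1 s2.
rewrite walk_cat last_rcons => /andP[w1 w2] ds s0.
exists (s2 ++ rcons s1 y); last by rewrite !size_cat addnC.
split; first by rewrite size_cat size_rcons addnS.
  exact: walk_trans w2 w1.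
by rewrite (defect_cat _ w2) addrC -(defect_cat _ w1).
Qed.

(** The walk is diverted at [z] along [c] to a vertex [v] of the loop [C]. The parts before and
    after [v] are shortened modulo [q], and turns around [C], which cost nothing, make up the length
    [k]. *)
Lemma walk_resize x s y z c k (C : T * seq T) : critical_loop z c ->
  critical_loop C.1 C.2 -> has [in C.2] c -> z \in x :: s -> walk x s y ->
  (2 * #|T| * size C.2 <= k)%N -> k = size s %[mod size C.2] ->
  exists s', [/\ walk x s' y, size s' = k & defect x s' <= defect x s].
Proof.
move=> [c0 wc dc] cC /hasP[v vc vC] zs ws kC ks.
set q := size C.2 in kC ks *.
have [r [r0 wr dr] sr] := critical_loop_rot cC vC.
have [s1 [s2 [es w1 w2]]] :
    exists s1 s2, [/\ s = s1 ++ s2, walk x s1 z & walk z s2 y].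
  case/splitPl: zs ws => s1 s2 ez; rewrite walk_cat ez => /andP[w1 w2].
  by exists s1, s2; split.
have [c1 [c2 [ec w3 w4]]] :
    exists c1 c2, [/\ c = c1 ++ c2, walk z c1 v & walk v c2 z].
  have {}vc : v \in z :: c by rewrite inE vc orbT.
  case/splitPl: vc wc => t1 t2 ez; rewrite walk_cat ez => /andP[v1 v2].
  by exists t1, t2; split.
have q0 : (0 < q)%N by rewrite /q; case: cC.
(* With [c1] and [c2], the [q.-1] extra turns make a detour of length [q * size c], which leaves the
   length unchanged modulo [q]. *)
have wR : walk v (c2 ++ loops q.-1 c ++ s2) y.
  exact: walk_trans w4 (walk_trans (walk_loops _ wc) w2).
have [l' [wl' sl' ml' dl']] := walk_reduce q0 (walk_trans w1 w3).
have [r' [wr' sr' mr' dr']] := walk_reduce q0 wR.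
have mlr : size (l' ++ r') = k %[mod q].
  rewrite size_cat -modnDm ml' mr' modnDm ks es !size_cat size_loops.
  rewrite [RHS](_ : _ = (q * size c + (size s1 + size s2)) %% q)%N ?[RHS]modnMDl.
    have -> : size c = (size c1 + size c2)%N by rewrite ec size_cat.
    congr (_ %% _)%N; rewrite -[X in _ = (X * _ + _)%N](prednK q0) mulSn.
    move: (q.-1 * _)%N; move: (size s1) (size s2) (size c1) (size c2).
    by clear; lia.
  by rewrite mulnC modnMDl.
have lrk : (size (l' ++ r') <= k)%N.
  by rewrite size_cat; move: sl' sr' kC; clear; lia.
have /dvdnP[t et] : (q %| k - size (l' ++ r'))%N by rewrite -eqn_mod_dvd // mlr.
exists (l' ++ loops t r ++ r'); split.
- exact: walk_trans wl' (walk_trans (walk_loops _ wr) wr').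
- by move: et lrk; rewrite !size_cat size_loops sr -/q; clear; lia.
- have dc' : defect z c1 + defect v c2 = 0 by rewrite -(defect_cat _ w3) -ec.
  rewrite (defect_cat _ wl') (defect_cat _ (walk_loops _ wr)).
  rewrite (defect_loops _ wr) dr.
  move: dl' dr'; rewrite es !(defect_cat _ w1) (defect_cat _ w4).
  rewrite (defect_cat _ (walk_loops _ wc)) (defect_loops _ wc) dc !mulr0 !add0r.
  move: (defect x s1) (defect z c1) (defect v c2) (defect z s2) dc'.
  by move: (defect x l') (defect v r'); clear; lia.
Qed.

End Defect.

Lemma walk_take m x s y : walk x s y -> walk x (take m s) (last x (take m s)).
Proof. by rewrite -{1}(cat_take_drop m s) walk_cat => /andP[]. Qed.

(** [f] is the optimal value of walks of given length, with initial reward [g]. The conclusion says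
    that [f k - (A / B) * k] depends only on [k] modulo [p], multiplied out to stay in [nat]. *)
Theorem optimal_walk_periodic (g : T -> nat) (G X : nat) (f : nat -> nat) :
  (forall x, (g x <= G)%N) -> (#|T| <= X ^ 2)%N ->
  (forall x s y, (0 < size s)%N -> walk x s y ->
    (g x + weight x s <= f (size s))%N) ->
  (forall K, exists x s y, [/\ size s = K, walk x s y &
    (f K <= g x + weight x s)%N]) ->
  let N := #|T| in
  let thr := (2 * N ^ 3 + N ^ 2 * G + N + 2 * N ^ 2 + 1)%N in
  exists A B p, [/\ (0 < B)%N, (0 < p)%N, (p <= X ^ (3 * X))%N &
    forall k K, (thr <= k)%N -> (thr <= K)%N -> k = K %[mod p] ->
      (B * f k + A * K = B * f K + A * k)%N].
Proof.
move=> gG NX f_ge f_le N thr.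
have [x0 [s0 [s0N w0 max0]]] :
    exists x s, [/\ (0 < size s <= N)%N, walk x s x &
    forall y s', walk y s' y ->
      (weight y s' * size s <= weight x s * size s')%N].
  have [x [s [y [sN ws _]]]] := f_le N.
  have [|s1 [s2 [s3 [z [_ s2n _ _ [w2 _]]]]]] := walk_cut (c := 1) isT ws.
    by rewrite muln1 sN.
  by apply: ratio_max w2; rewrite muln1 in s2n.
set A := weight x0 s0; set B := size s0.
have AB : (A <= B)%N := weight_le_size _ _.
have /andP[B0 BN] : (0 < B <= N)%N := s0N.
have dge0 x s : walk x s x -> 0 <= defect A B x s.
  by move=> /max0; rewrite /defect -/A -/B; lia.
have [Cs [Cc Csz Ch]] := critical_loop_family dge0 [set: T].
pose big := [seq C <- Cs | (X < size C.2)%N].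
pose p := (X`! * \prod_(C <- big) size C.2)%N.
exists A, B, p.
have CN C : C \in Cs -> (size C.2 <= N)%N.
  move=> CC; rewrite /N -(cardsT T); apply: leq_trans Csz.
  by rewrite (big_rem C) //= leq_addr.
have bigX : (size big <= X)%N.
  have h : (size big * X <= \sum_(C <- big) size C.2)%N.
    rewrite -sum1_size big_distrl /= big_seq [leqRHS]big_seq.
    by apply: leq_sum => C; rewrite mem_filter mul1n => /andP[/ltnW].
  have h2 : (\sum_(C <- big) size C.2 <= X ^ 2)%N.
    apply: leq_trans NX; rewrite -cardsT; apply: leq_trans Csz.
    by rewrite big_filter [leqRHS](bigID (fun C => X < size C.2)%N) leq_addr.
  case: (posnP X) => [X0|X0]; last by rewrite -(leq_pmul2r X0); lia.
  by move: NX; rewrite X0; move: B0 BN; rewrite /N; lia.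
split=> //.
- rewrite muln_gt0 fact_gt0 /= big_filter prodn_cond_gt0 //.
  by move=> C; apply: leq_ltn_trans.
- rewrite /p mulSn expnD leq_mul //.
    elim: (X) => // m IH; rewrite factS expnS leq_mul //.
    by apply: leq_trans IH _; case: (m) => // l; rewrite leq_exp2r.
  apply: (@leq_trans (\prod_(C <- big) X ^ 2)).
    rewrite big_seq [leqRHS]big_seq; apply: leq_prod => C.
    by rewrite mem_filter => /andP[_ /CN]/leq_trans; apply.
  rewrite big_const_seq count_predT iter_muln_1 expnM leq_pexp2l //.
  by rewrite (leq_trans _ NX) // (leq_trans B0).
move=> k K kt Kt kK.
(* By symmetry one inequality is enough: an optimal walk of length [K'] is resized to length [k']
   without raising its defect. *)
suff main k' K' : (thr <= k')%N -> (thr <= K')%N -> k' = K' %[mod p] ->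
    (B * f K' + A * k' <= B * f k' + A * K')%N.
  by have := main k K kt Kt kK; have := main K k Kt kt (esym kK); lia.
move=> {k K kt Kt kK} kt Kt kK.
have [x [s [y [sK ws fs]]]] := f_le K'.
(* Turning around the best cycle and stopping partway through the last turn loses at most
   [A * B]. *)
have f_low : (A * K' <= B * f K' + N ^ 2)%N.
  have wl := walk_loops (K' %/ B) w0.
  have wt := walk_take (K' %% B) w0.
  have sl : size (loops (K' %/ B) s0 ++ take (K' %% B) s0) = K'.
    rewrite size_cat size_loops size_takel -/B -?divn_eq //.
    by rewrite ltnW // ltn_pmod.
  have := f_ge _ _ _ _ (walk_trans wl wt).
  rewrite sl => /(_ _)/wrap[]; first lia.
  have : defect A B x0 (loops (K' %/ B) s0 ++ take (K' %% B) s0) <= (A * B)%:Z.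
    rewrite (defect_cat _ _ _ wl) (defect_loops _ _ _ w0).
    have -> : defect A B x0 s0 = 0 by rewrite /defect -/A -/B; lia.
    rewrite mulr0 add0r /defect size_takel; last by rewrite ltnW // ltn_pmod.
    by have := ltn_pmod K' B0; move: (K' %% B)%N (weight _ _); clear; nia.
  rewrite /defect sl; move: (weight _ _) => W h2 h1.
  have h3 : (B * W <= B * f K')%N by rewrite leq_mul2l; move: h1; lia.
  have h4 : (A * B <= N ^ 2)%N by rewrite -mulnn leq_mul // (leq_trans AB).
  by move: h2 h3 h4; clear; lia.
have BW : (B * f K' <= B * g x + B * weight x s)%N.
  by rewrite -mulnDr leq_mul2l fs orbT.
(* By [f_low] the optimal walk has defect at most [N * G + N ^ 2]; without critical vertices its
   length would be at most [2 * N ^ 3 + N ^ 2 * G + N], which is below [thr]. *)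
have [z [zs [c cz]]] : exists z, z \in x :: s /\ critical A B z.
  apply: contrapT => nc.
  have /(_ _)/wrap[v vs cv|] := noncritical_defect dge0 _ ws.
    by apply: nc; exists v.
  have Bg : (B * g x <= N * G)%N by rewrite leq_mul.
  have dN : defect A B x s + B%:Z * N%:Z <= (N * G + 2 * N ^ 2)%:Z.
    have : (B * N <= N ^ 2)%N by rewrite -mulnn leq_mul2r BN orbT.
    by rewrite /defect sK; move: f_low BW Bg; clear; lia.
  rewrite -/N sK => le1.
  have : N%:Z * (defect A B x s + B%:Z * N%:Z) <= N%:Z * (N * G + 2 * N ^ 2)%:Z.
    by rewrite ler_wpM2l.
  have -> : N%:Z * (N * G + 2 * N ^ 2)%:Z = (N ^ 2 * G + 2 * N ^ 3)%:Z.
    by rewrite -PoszM mulnDr mulnA mulnn mulnCA -expnS.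
  by move: le1 Kt; rewrite /thr; clear; lia.
have [C CC hC] := Ch _ _ cz (fun v _ => finset.in_setT v).
have qN := CN _ CC.
have qp : (size C.2 %| p)%N.
  have [q0 _ _] := Cc _ CC.
  have [le|lt] := leqP (size C.2) X.
    by rewrite dvdn_mulr // dvdn_fact // q0.
  rewrite dvdn_mull // (big_rem C) ?dvdn_mulr //.
  by rewrite mem_filter lt.
have [||s' [ws' ss' ds']] := walk_resize dge0 cz (Cc _ CC) hC zs ws (k := k').
- have h : (2 * N * size C.2 <= 2 * N ^ 2)%N.
    by rewrite -mulnA -mulnn !leq_mul2l qN !orbT.
  by apply: leq_trans h _; move: kt; rewrite /thr; clear; lia.
- by rewrite sK -(modn_dvdm k' qp) kK modn_dvdm.
have := f_ge _ _ _ _ ws'; rewrite ss' => /(_ _)/wrap[].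
  by move: kt; rewrite /thr; clear; lia.
rewrite -(leq_pmul2l B0) mulnDr => Bk'.
by move: ds'; rewrite /defect ss' sK; move: BW Bk'; clear; lia.
Qed.

End Walks.

(** * Dimension and classes modulo the integers *)

Section Dimension.
Local Open Scope classical_set_scope.
Variables (R : realType) (k : nat).
Implicit Types (P S : set 'rV[R]_k) (z : 'rV[R]_k).

Lemma polyhedron_halfspace (A : 'cV[R]_k) (b : R) :
  polyhedron [set x | (x *m A) 0 0 <= b].
Proof.
exists 1%N, A, (const_mx b); apply/seteqP; split=> x /=.
  by move=> h i; rewrite ord1 [leRHS]mxE.
by move=> /(_ 0); rewrite [leRHS]mxE.
Qed.

Lemma polyhedronI P S : polyhedron P -> polyhedron S -> polyhedron (P `&` S).
Proof.
move=> [m1 [A1 [b1 ->]]] [m2 [A2 [b2 ->]]].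
exists (m1 + m2)%N, (row_mx A1 A2), (row_mx b1 b2).
apply/seteqP; split=> x /=; rewrite mul_mx_row.
  by move=> [h1 h2] i; rewrite !mxE; case: splitP => j _.
move=> h; split=> i; first by have := h (lshift _ i); rewrite !row_mxEl.
by have := h (rshift _ i); rewrite !row_mxEr.
Qed.

Lemma polyhedron_forall (I : finType) (F : I -> set 'rV[R]_k) :
  (forall i, polyhedron (F i)) -> polyhedron [set x | forall i, F i x].
Proof.
move=> pF; have -> : [set x | forall i, F i x] =
    [set x | forall i, i \in enum I -> F i x].
  by apply/seteqP; split=> x /= h i; [|apply: h; rewrite mem_enum].
elim: (enum I) => [|i s IH].
  exists 0%N, 0, 0; apply/seteqP; split=> x //= _; by case.
rewrite (_ : [set _ | _] = F i `&` [set x | forall j, j \in s -> F j x]).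
  exact: polyhedronI.
apply/seteqP; split=> x /=.
  by move=> h; split=> [|j js]; apply: h; rewrite inE ?eqxx // js orbT.
by move=> [h1 h2] j; rewrite inE => /predU1P[->|/h2].
Qed.

Lemma polyhedron_le_coord i (b : R) : polyhedron [set x : 'rV_k | x 0 i <= b].
Proof.
have := polyhedron_halfspace (delta_mx i 0) b.
by under eq_set do rewrite -colE mxE.
Qed.

Lemma polyhedron_ge_coord i (b : R) : polyhedron [set x : 'rV_k | b <= x 0 i].
Proof.
have := polyhedron_halfspace (- delta_mx i 0) (- b).
by under eq_set do rewrite mulmxN -colE 2!mxE lerN2.
Qed.

Lemma polyhedron_le_diff i j (b : R) :
  polyhedron [set x : 'rV_k | x 0 i - x 0 j <= b].
Proof.
have := polyhedron_halfspace (delta_mx i 0 - delta_mx j 0) b.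
by under eq_set do rewrite mulmxBr -!colE !mxE.
Qed.

Definition congr_int z (i j : 'I_k) : bool := z 0 i - z 0 j \is a Num.int.

Lemma congr_int_refl z i : congr_int z i i.
Proof. by rewrite /congr_int subrr rpred0. Qed.

Lemma congr_int_sym z i j : congr_int z i j = congr_int z j i.
Proof. by rewrite /congr_int -rpredN opprB. Qed.

Lemma congr_int_trans z j i l :
  congr_int z i j -> congr_int z j l -> congr_int z i l.
Proof.
by rewrite /congr_int => h1 h2; rewrite -(subrKA (z 0 j)) rpredD.
Qed.

(** The least index of each class of entries modulo the integers, so the cardinality counts the
    classes. *)
Definition leaders z : {set 'I_k} :=
  [set i : 'I_k | [forall j : 'I_k, (j < i)%N ==> ~~ congr_int z i j]].

Lemma leaderP z i : exists2 l, l \in leaders z & congr_int z i l.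
Proof.
case: (arg_minnP (fun j : 'I_k => val j) (congr_int_refl z i)) => l il lmin.
exists l => //; rewrite inE; apply/forallP => j; apply/implyP => jl.
apply/negP => lj; have := lmin j (congr_int_trans il lj) => /= /(leq_trans jl).
by rewrite ltnn.
Qed.

Lemma leaders_congr z i j : i \in leaders z -> j \in leaders z ->
  congr_int z i j -> i = j.
Proof.
rewrite !inE => /forallP iz /forallP jz ij; apply/val_inj.
case: (ltngtP i j) => // h.
  by have := jz i; rewrite h congr_int_sym ij.
by have := iz j; rewrite h ij.
Qed.

Lemma pos_lower_bound (I : finType) (f : I -> R) :
  exists2 eps, 0 < eps & forall i, 0 < f i -> eps <= f i.
Proof.
exists (\big[Num.min/1]_(i | 0 < f i) f i); last first.
  by move=> i; apply: bigmin_le_cond.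
by apply/bigmin_gtP; split.
Qed.

Lemma has_aff_indep_aff_dim P m : has_aff_indep P m -> (m <= aff_dim P)%N.
Proof.
move=> hP; have mk : (m < k.+1)%N.
  by case: hP => x [B [_ _ /eqP<-]]; rewrite ltnS rank_leq_col.
by apply: (bigop.bigmax_sup (Ordinal mk)) => //; apply/asboolP.
Qed.

Lemma aff_dim_polyhedral_dim P S : polyhedron P -> P `<=` S ->
  (aff_dim P <= polyhedral_dim S)%N.
Proof.
move=> pP PS; have mk : (aff_dim P < k.+1)%N.
  by rewrite ltnS; apply/bigop.bigmax_leqP => m _; rewrite -ltnS.
by apply: (bigop.bigmax_sup (Ordinal mk)) => //; apply/asboolP; exists P.
Qed.

(** Up to sign [0 < d], and for small [t] the value lies strictly between [Num.floor y] and the next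
    integer, even when [y] is an integer. *)
Lemma nonint_stable (y d : R) : (y \isn't a Num.int) || (d != 0) ->
  exists2 t0, 0 < t0 & forall t, 0 < t < t0 -> y + t * d \isn't a Num.int.
Proof.
wlog d0 : y d / 0 <= d.
  move=> wl h; have [/wl|d0] := leP 0 d; first exact.
  have [||t0 t00 ht] := wl (- y) (- d).
  - by rewrite oppr_ge0 ltW.
  - by rewrite rpredN oppr_eq0.
  by exists t0 => // t /ht; rewrite mulrN -opprD rpredN.
rewrite orbC; have [->|dn0 _] := eqVneq d 0.
  by move=> /= yn; exists 1 => // t _; rewrite mulr0 addr0.
have {d0 dn0} d0 : 0 < d by rewrite lt_def dn0.
pose c : int := Num.floor y + 1.
have yc : y < c%:~R by by case/andP: (floor_itv y).
exists ((c%:~R - y) / d) => [|t /andP[t0 tt]].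
  by rewrite divr_gt0 ?subr_gt0.
rewrite ltr_pdivlMr // in tt.
apply/negP => /intrP[m em].
have h1 : y < m%:~R by rewrite -em ltrDl mulr_gt0.
have h2 : (m%:~R : R) < c%:~R by rewrite -em -ltrBrDl.
have h3 : ((Num.floor y)%:~R : R) < m%:~R := le_lt_trans (floor_le y) h1.
by move: h2 h3; rewrite !ltr_int /c; lia.
Qed.

(* The witness is a point with the fewest integer differences: moving slightly
   towards another point of [P] keeps non-integers non-integer. *)
Lemma polyhedron_generic P : polyhedron P -> P !=set0 ->
  exists2 z, P z & forall x i j, P x -> congr_int z i j ->
    x 0 i - x 0 j = z 0 i - z 0 j.
Proof.
move=> [p [A [b PE]]] [z0 Pz0].
pose pairs z := [set q : 'I_k * 'I_k | congr_int z q.1 q.2]%SET.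
pose Q m := `[< exists2 z, P z & #|pairs z| = m >].
have exQ : exists m, Q m by exists #|pairs z0|; apply/asboolP; exists z0.
case: (ex_minnP exQ) => _ /asboolP[z Pz <-] zmin.
exists z => // x i j Px ij; apply: contrapT => /eqP xz.
pose d (q : 'I_k * 'I_k) := (x 0 q.1 - x 0 q.2) - (z 0 q.1 - z 0 q.2).
pose y (q : 'I_k * 'I_k) := z 0 q.1 - z 0 q.2.
have /choice[t0 ht0] q : exists t0, 0 < t0 /\
    (((y q \isn't a Num.int) || (d q != 0)) ->
     forall t, 0 < t < t0 -> y q + t * d q \isn't a Num.int).
  have [yd|_] := boolP ((y q \isn't a Num.int) || (d q != 0)); last by exists 1.
  by have [t0 t00 h] := nonint_stable yd; exists t0.
have [eps eps0 epst] := pos_lower_bound t0.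
pose t := Num.min eps 1 / 2.
have t1 : 0 < t by rewrite divr_gt0 // lt_min eps0 ltr01.
have tmin : t < Num.min eps 1.
  by rewrite ltr_pdivrMr // ltr_pMr ?ltr1n // lt_min eps0 ltr01.
have [te /ltW tle1] : t < eps /\ t < 1 by apply/andP; rewrite -lt_min.
pose zt := z + t *: (x - z).
have ztE q : zt 0 q.1 - zt 0 q.2 = y q + t * d q.
  by rewrite /zt /y /d !mxE; ring.
have Pzt : P zt.
  move: Pz Px; rewrite PE => /= hz hx l.
  have -> : zt = (1 - t) *: z + t *: x.
    by rewrite /zt scalerBr scalerBl scale1r addrAC addrA.
  rewrite mulmxDl -!scalemxAl !mxE.
  have := hz l; have := hx l; rewrite !mxE.
  move: (\sum_(_ <- _ | _) _) (\sum_(_ <- _ | _) _) => u v; nra.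
have /zmin : Q #|pairs zt| by apply/asboolP; exists zt.
apply/negP; rewrite -ltnNge; apply: proper_card.
apply/properP; split.
  apply/fintype.subsetP => q; rewrite !inE /congr_int ztE => h.
  apply/negPn/negP => ny; move: h; apply/negP; apply: (ht0 q).2.
    by rewrite -/(y q) in ny; rewrite ny.
  by rewrite t1 (lt_le_trans te) // epst // (ht0 q).1.
exists (i, j); rewrite inE // /congr_int (ztE (i, j)); apply: (ht0 (i, j)).2.
  by rewrite /d subr_eq0 xz orbT.
by rewrite t1 (lt_le_trans te) // epst // (ht0 _).1.
Qed.

(** At a generic point [z] of a polyhedron, differences within a class are constant on the whole
    polyhedron. Its directions are thus constant on classes, and [B] factors through the class
    indicator matrix [E]. *)
Lemma polyhedral_dim_le S (m : nat) :
  (forall z, S z -> (#|leaders z| <= m)%N) -> (polyhedral_dim S <= m)%N.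
Proof.
move=> lm; apply/bigop.bigmax_leqP => l /asboolP[P [pP PS <-]].
apply/bigop.bigmax_leqP => {}l /asboolP[x [B [xP xBP freeB]]].
rewrite inE in xP.
have [|z Pz zP] := polyhedron_generic pP; first by exists x.
apply: leq_trans (lm z (PS _ Pz)).
pose B1 := \matrix_(i, q) B i (enum_val q) : 'M[R]_(l, #|leaders z|).
pose E := \matrix_(q, j) ((congr_int z j (enum_val q))%:R : R)
   : 'M[R]_(#|leaders z|, k).
have BE : B = B1 *m E.
  apply/matrixP => i j; rewrite !mxE.
  have [q0 q0l jq0] := leaderP z j.
  rewrite (bigD1 (enum_rank_in q0l q0)) //= !mxE enum_rankK_in // jq0 mulr1.
  rewrite big1 ?addr0 => [|q qq0].
    have xi : P (x + row i B) by have := xBP i; rewrite inE.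
    have := zP _ _ _ xi jq0; rewrite -(zP _ _ _ xP jq0) !mxE; lra.
  rewrite !mxE; case: (boolP (congr_int z j (enum_val q))) => jq; last first.
    by rewrite mulr0.
  case/eqP: qq0; apply: enum_val_inj; rewrite enum_rankK_in //.
  apply: (leaders_congr (enum_valP q) q0l).
  by apply: congr_int_trans jq0; rewrite congr_int_sym.
move: freeB => /eqP <-; rewrite BE; exact: mulmx_max_rank.
Qed.

End Dimension.

(** * Dimension bounded below by the number of classes *)

Section Solutions.
Local Open Scope classical_set_scope.
Variables (R : realType) (n : nat) (a : 'rV[int]_n.+1) (k : nat).
Let aR : 'rV[R]_n.+1 := map_mx intr a.

(** Each class can be raised by [eps] independently. Entries tied in a window are congruent because
    [a] is integral, so they move together; [eps] is at most every positive gap, so minimal entries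
    stay minimal. *)
Lemma leaders_trop_hilbert (z : 'rV[R]_k) : trop_sols aR k z ->
  (#|leaders z| <= trop_hilbert aR k)%N.
Proof.
move=> zD.
pose gap (q : 'I_(k - n) * 'I_n.+1 * 'I_n.+1) :=
  (z 0 (window q.1.1 q.1.2) + aR 0 q.1.2) - (z 0 (window q.1.1 q.2) + aR 0 q.2).
have [eps eps0 gape] := pos_lower_bound gap.
(* Congruence is symmetric, so the third condition, applied to a pair in both orders, fixes the
   differences within a class. *)
pose P := [set x : 'rV[R]_k | forall i, x 0 i <= z 0 i + eps] `&`
  [set x : 'rV[R]_k | forall i, z 0 i <= x 0 i] `&`
  [set x : 'rV[R]_k | forall q : {q : 'I_k * 'I_k | congr_int z q.1 q.2},
     x 0 (sval q).1 - x 0 (sval q).2 <= z 0 (sval q).1 - z 0 (sval q).2].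
have pP : polyhedron P.
  apply: polyhedronI; first apply: polyhedronI.
  - by apply: polyhedron_forall => i; apply: polyhedron_le_coord.
  - by apply: polyhedron_forall => i; apply: polyhedron_ge_coord.
  - by apply: polyhedron_forall => q; apply: polyhedron_le_diff.
have PD : P `<=` trop_sols aR k.
  move=> x [[x1 x2] x3] j.
  have [i1 [i2 [i12 m1 m2]]] := zD j.
  suff H i :
      (forall l, z 0 (window j i) + aR 0 i <= z 0 (window j l) + aR 0 l) ->
      forall l, x 0 (window j i) + aR 0 i <= x 0 (window j l) + aR 0 l.
    by exists i1, i2; split=> //; apply: H.
  move=> im l; have := im l; rewrite le_eqVlt => /predU1P[e|lt].
    have il : congr_int z (window j i) (window j l).
      rewrite /congr_int (_ : _ - _ = aR 0 l - aR 0 i); last by lra.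
      by rewrite !mxE rpredB ?intr_int.
    by have := x3 (exist _ (_, _) il) => /=; lra.
  have := gape (j, l, i); rewrite /gap /= subr_gt0 => /(_ lt).
  by have := x1 (window j i); have := x2 (window j l); lra.
apply: leq_trans (aff_dim_polyhedral_dim pP PD).
apply: has_aff_indep_aff_dim.
pose B := \matrix_(q < #|leaders z|, j < k)
  (if congr_int z j (enum_val q) then eps else 0).
exists z, B; split.
- rewrite inE; split; first split; move=> //= i; first by rewrite lerDl ltW.
- move=> q; rewrite inE; split; first split.
  + by move=> i /=; rewrite !mxE; case: ifP => _; lra.
  + by move=> i /=; rewrite !mxE; case: ifP => _; lra.
  + move=> [[i j] /= ij] /=; rewrite !mxE.
    have -> : congr_int z i (enum_val q) = congr_int z j (enum_val q).
      by apply/idP/idP; apply: congr_int_trans; rewrite // congr_int_sym.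
    lra.
- apply/row_freeP.
  exists (\matrix_(j, q) (if j == enum_val q then eps^-1 else 0)).
  apply/matrixP => q q'; rewrite !mxE (bigD1 (enum_val q')) //= big1 => [|j jq'].
    rewrite addr0 !mxE eqxx; have [->|qq'] := eqVneq q q'.
      by rewrite congr_int_refl mulfV // gt_eqF.
    case: ifP => [h|_]; last by rewrite mul0r.
    case/eqP: qq'; apply: enum_val_inj.
    apply: leaders_congr (enum_valP q) (enum_valP q') _.
    by rewrite congr_int_sym.
  by rewrite !mxE (negbTE jq') mulr0.
Qed.

End Solutions.

(** * Solutions as sequences, and their truncation *)

Section Sequences.
Variables (R : realType) (n : nat) (a : 'rV[int]_n.+1).
Implicit Type z : nat -> R.
Let aR : 'rV[R]_n.+1 := map_mx intr a.

Definition tight z j :=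
  min_attained_twice (fun i : 'I_n.+1 => z (j + i)%N + (a 0 i)%:~R).

Definition solution k z := forall j, (j + n < k)%N -> tight z j.

Definition fresh z l : bool :=
  [forall l' : 'I_l, z l - z l' \isn't a Num.int].

Definition nclasses z k : nat := \sum_(l < k) fresh z l.

Lemma solution_trop_sols k z :
  solution k z <-> trop_sols aR k (\row_(i < k) z i).
Proof.
have E (j : 'I_(k - n)) :
    (fun i => (\row_(i < k) z i) 0 (window j i) + aR 0 i) =
    (fun i : 'I_n.+1 => z (j + i)%N + (a 0 i)%:~R).
  by apply/funext => i; rewrite !mxE.
split=> [sz j|sz j jn]; first by rewrite E; apply: sz; have := ltn_ord j; lia.
have jk : (j < k - n)%N by lia.
by have := sz (Ordinal jk); rewrite E.
Qed.

Lemma nclasses_leaders k z : nclasses z k = #|leaders (\row_(i < k) z i)|.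
Proof.
rewrite -sum1_card big_mkcond; apply: eq_bigr => l _ /=.
rewrite inE; congr nat_of_bool; apply/forallP/forallP => [h j|h j].
  by apply/implyP => jl; have := h (Ordinal jl); rewrite /congr_int !mxE.
have jk : (j < k)%N by apply: ltn_trans (ltn_ord j) (ltn_ord l).
by have := h (Ordinal jk); rewrite /congr_int !mxE /= ltn_ord.
Qed.

Lemma nclasses_le k z : solution k z -> (nclasses z k <= trop_hilbert aR k)%N.
Proof.
move=> /solution_trop_sols zs; rewrite nclasses_leaders.
exact: leaders_trop_hilbert.
Qed.

Definition upd z (k : nat) x (l : nat) : R := if l == k then x else z l.

Lemma upd_ne z k x l : l != k -> upd z k x l = z l.
Proof. by rewrite /upd => /negbTE->. Qed.

Lemma upd_lt z k x l : (l < k)%N -> upd z k x l = z l.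
Proof. by move=> lk; rewrite upd_ne // ltn_eqF. Qed.

Lemma tight_upd z k x j : (j + n < k)%N -> tight z j -> tight (upd z k x) j.
Proof.
move=> jk; rewrite /tight (_ : (fun i : 'I_n.+1 => upd _ _ _ _ + _) =
  (fun i : 'I_n.+1 => z (j + i)%N + (a 0 i)%:~R)) //.
by apply/funext => i; rewrite upd_lt //; have := ltn_ord i; lia.
Qed.

Hypothesis n_gt0 : (0 < n)%N.

Lemma solution_exists k : exists z, solution k z.
Proof.
elim: k => [|k [z zs]]; first by exists (fun=> 0).
have [kn|nk] := ltnP k n; first by exists z => j; lia.
pose F (i : 'I_n.+1) := z (k - n + i)%N + (a 0 i)%:~R.
have [i0 i0n imin] :=
  arg_minP F (i0 := ord0) (P := fun i : 'I_n.+1 => (i < n)%N) n_gt0.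
exists (upd z k (F i0 - (a 0 ord_max)%:~R)) => j jk.
have [jn|jn] := ltnP (j + n) k; first exact/tight_upd/zs.
have -> : j = (k - n)%N by lia.
have new (i : 'I_n.+1) :
    upd z k (F i0 - (a 0 ord_max)%:~R) (k - n + i)%N + (a 0 i)%:~R =
    if (i < n)%N then F i else F i0.
  case: ifP => [lt|/negbT ge]; first by rewrite upd_lt //; lia.
  have -> : i = ord_max by apply/val_inj; have := ltn_ord i; rewrite /=; lia.
  by rewrite /upd /= subnK // eqxx subrK.
exists i0, ord_max; split.
- by apply: contraTneq i0n => ->; rewrite ltnn.
- by move=> i; rewrite !new i0n; case: ifP => // /imin.
- by move=> i; rewrite !new ltnn; case: ifP => // /imin.
Qed.

(** If all solutions had fewer classes, [polyhedral_dim_le] would bound the dimension by its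
    predecessor; the existence of a solution makes the dimension positive, a contradiction. *)
Lemma nclasses_attained k :
  exists2 z, solution k z & (trop_hilbert aR k <= nclasses z k)%N.
Proof.
apply: contrapT => none.
have lt z : solution k z -> (nclasses z k < trop_hilbert aR k)%N.
  by move=> zs; rewrite ltnNge; apply/negP => h; apply: none; exists z.
have [z0 /lt z0s] := solution_exists k.
have : (trop_hilbert aR k <= (trop_hilbert aR k).-1)%N; last by lia.
apply: polyhedral_dim_le => z zs.
pose u l := if insub l is Some i then z 0 i else 0.
have ez : z = \row_(i < k) u i by apply/rowP => i; rewrite mxE /u valK.
have : solution k u by apply/solution_trop_sols; rewrite -ez.
by move=> /lt; rewrite nclasses_leaders -ez; lia.
Qed.

(** * Truncation of large entries *)

Section Clamp.
Variables (M : nat) (alpha : int).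
Hypothesis aM : forall i, alpha <= a 0 i <= alpha + M%:Z.

Let aMR i j : (a 0 i)%:~R <= (a 0 j)%:~R + M%:R :> R.
Proof.
rewrite -[M%:R]/((M%:Z)%:~R) -intrD ler_int.
by have := aM i; have := aM j; lia.
Qed.

Definition block_bounded (L : nat) k z :=
  forall l l', (l < k)%N -> (l' < k)%N -> (l < l' + n)%N ->
    (l' < l + n)%N -> z l - z l' <= L%:R.

(** The minimum [m j] of [n] consecutive entries moves by at most [M] per step: of two minimal
    places in a window, one is not the first and one is not the last. Large entries are lowered by
    integers to just above a height [h] measured from [m]. *)
Lemma solution_clamp k z : (0 < M)%N -> (n <= k)%N -> solution k z -> exists z',
  [/\ solution k z', forall l, z' l - z l \is a Num.int &
      block_bounded (5 * n * M) k z'].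
Proof.
move=> M0 nk zs.
have /choice[m hm] j : exists m, (forall i, (i < n)%N -> m <= z (j + i)%N) /\
    exists2 i : 'I_n, true & m = z (j + i)%N.
  have [i _ imin] := arg_minP (fun i : 'I_n => z (j + i)%N)
    (i0 := Ordinal n_gt0) (P := xpredT) isT.
  exists (z (j + i)%N); split; last by exists i.
  by move=> i' i'n; apply: (imin (Ordinal i'n)).
have m_le j i : (i < n)%N -> m j <= z (j + i)%N by apply: (hm j).1.
pose minimal j (i : 'I_n.+1) := forall i' : 'I_n.+1,
  z (j + i)%N + (a 0 i)%:~R <= z (j + i')%N + (a 0 i')%:~R.
have minimal_le j i i' : minimal j i ->
    z (j + i)%N + (a 0 i)%:~R <= m j + M%:R + (a 0 i')%:~R.
  move=> imin; have [_ [q _ ->]] := hm j.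
  have := imin (widen_ord (leqnSn n) q) => /=.
  by have := aMR (widen_ord (leqnSn n) q) i'; lra.
have m_up j : (j + n < k)%N -> m j.+1 <= m j + M%:R.
  move=> /zs[i1 [i2 [i12 h1 h2]]].
  have [i i0 hi] : exists2 i : 'I_n.+1, (0 < i)%N & minimal j i.
    have [i10|] := posnP i1; last by exists i1.
    exists i2 => //; rewrite lt0n -i10.
    by apply: contra i12 => /eqP/val_inj->; exact: eqxx.
  have := minimal_le _ _ i hi; have := m_le j.+1 i.-1.
  rewrite addSnnS prednK // => /(_ _)/wrap[]; first by have := ltn_ord i; lia.
  by lra.
have last_ge j : (j + n < k)%N -> m j <= z (j + n)%N + M%:R.
  move=> /zs[i1 [i2 [i12 h1 h2]]].
  have [i i0 hi] : exists2 i : 'I_n.+1, (i < n)%N & minimal j i.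
    have [i1n|] := ltnP i1 n; first by exists i1.
    move=> ni1; exists i2 => //; have := ltn_ord i1; have := ltn_ord i2.
    move: i12; rewrite -val_eqE /=; lia.
  have := hi ord_max; have := m_le j i i0; have := aMR ord_max i.
  by rewrite /=; lra.
have m_down j : (j + n < k)%N -> m j <= m j.+1 + M%:R.
  move=> jn; have [_ [q _ ->]] := hm j.+1; rewrite addSnnS.
  have [qn|qn] := ltnP q.+1 n; last first.
    by have -> : q.+1 = n; [have := ltn_ord q; lia|exact: last_ge].
  by have := m_le j q.+1 qn; have := ler0n R M; lra.
have m_dist j q : (j + q + n <= k)%N ->
    m (j + q)%N <= m j + q%:R * M%:R /\ m j <= m (j + q)%N + q%:R * M%:R.
  elim: q => [|q IH] jq; first by rewrite addn0 mul0r addr0.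
  have [|u1 u2] := IH _; first lia.
  have jqn : (j + q + n < k)%N by lia.
  have := m_up _ jqn; have := m_down _ jqn.
  by rewrite addnS -natr1 mulrDl mul1r; split; lra.
(* At most [n] steps of [m] cost [M] each, and the offsets [a] cost one more [M]. For [l < n] the
   truncated subtraction gives [m 0]. *)
pose h l := m (l - n)%N + n.+1%:R * M%:R.
(* An entry above [h l] attains the minimum in no window containing it. *)
pose z' l :=
  if z l <= h l + 1 then z l else z l - (Num.floor (z l - h l) - 1)%:~R.
have z'P l : z' l = z l \/ h l < z l /\ h l < z' l.
  rewrite /z'; case: (leP (z l) (h l + 1)) => hl; [by left|right].
  by have /andP[] := floor_itv (z l - h l); rewrite !intrD; lra.
have z'h l : z' l <= h l + 2.
  rewrite /z'; case: (leP (z l) (h l + 1)) => hl; first by lra.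
  by have /andP[] := floor_itv (z l - h l); rewrite !intrD; lra.
have M0R : 0 < M%:R :> R by rewrite ltr0n.
have z'm l : (l < k)%N -> m (l - n)%N <= z' l + M%:R.
  move=> lk; case: (z'P l) => [->|[_]]; last first.
    have : 0 <= n.+1%:R * M%:R :> R by rewrite mulr_ge0.
    rewrite /h; lra.
  have [ln|nl] := ltnP l n; last first.
    by rewrite -{2}(subnK nl); apply: last_ge; rewrite subnK.
  have -> : (l - n = 0)%N by lia.
  by have := m_le 0%N l ln; rewrite add0n; lra.
exists z'; split.
- move=> j jn.
  have low (i i' : 'I_n.+1) : minimal j i ->
      z (j + i)%N + (a 0 i)%:~R <= h (j + i')%N + (a 0 i')%:~R.
    move=> /(minimal_le _ _ i').
    pose q := (j - (j + i' - n))%N.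
    have jq : (j = j + i' - n + q)%N by have := ltn_ord i'; rewrite /q; lia.
    have [|+ _] := m_dist (j + i' - n)%N q; first by rewrite -jq ltnW.
    rewrite -jq /h.
    have : q%:R * M%:R <= n%:R * M%:R :> R.
      by rewrite ler_pM2r // ler_nat /q; have := ltn_ord i'; lia.
    by rewrite -natr1 mulrDl mul1r; lra.
  have keep (i : 'I_n.+1) : minimal j i -> z' (j + i)%N = z (j + i)%N.
    by move=> /(low i i); case: (z'P (j + i)%N) => // -[]; lra.
  have new (i : 'I_n.+1) : minimal j i -> forall i' : 'I_n.+1,
      z' (j + i)%N + (a 0 i)%:~R <= z' (j + i')%N + (a 0 i')%:~R.
    move=> im i'; rewrite keep //.
    by case: (z'P (j + i')%N) => [->|[_]]; [exact: im|have := low i i' im; lra].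
  have [i1 [i2 [i12 h1 h2]]] := zs _ jn.
  by exists i1, i2; split=> //; apply: new.
- move=> l; rewrite /z'; case: ifP => _; first by rewrite subrr rpred0.
  by rewrite addrAC subrr add0r rpredN intr_int.
- move=> l l' lk l'k ll' l'l.
  have mm : m (l - n)%N <= m (l' - n)%N + (n%:R - 1) * M%:R.
    have [le|lt] := leqP (l - n) (l' - n).
      have [|_] := m_dist (l - n)%N (l' - n - (l - n))%N; first lia.
      rewrite subnKC // => h1; apply: le_trans h1 _; rewrite lerD2l ler_pM2r //.
      by rewrite lerBrDr natr1 ler_nat; lia.
    have [|h1 _] := m_dist (l' - n)%N (l - n - (l' - n))%N; first lia.
    rewrite subnKC in h1; last by rewrite ltnW.
    apply: le_trans h1 _; rewrite lerD2l ler_pM2r //.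
    by rewrite lerBrDr natr1 ler_nat; lia.
  (* The bounds add up to [(n - 1) * M + (n + 1) * M + 2 + M], which is at most [5 * n * M]. *)
  have := z'h l; have := z'm l' l'k; rewrite /h !natrM -natr1.
  have n1 : 1 <= n%:R :> R by rewrite ler1n.
  have M1 : 1 <= M%:R :> R by rewrite ler1n.
  by nra.
Qed.

End Clamp.
End Sequences.

(** * Order types of windows *)

Section IntegerParts.
Variable R : realType.
Implicit Types x y : R.

Lemma strict_int_le x (f c : int) : f%:~R < x < f%:~R + 1 ->
  (x <= c%:~R) = (f + 1 <= c).
Proof.
move=> /andP[fx xf]; apply/idP/idP => [xc|fc].
  by have := lt_le_trans fx xc; rewrite ltr_int; lia.
by rewrite (le_trans (ltW xf)) // -[1]/(1%:~R) -intrD ler_int.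
Qed.

Lemma floor_strict x : x \isn't a Num.int ->
  (Num.floor x)%:~R < x < (Num.floor x)%:~R + 1.
Proof.
move=> xn; have /andP[h1 h2] := floor_itv x.
rewrite intrD in h2; rewrite h2 andbT lt_neqAle h1 andbT.
by apply: contra xn => /eqP <-; apply: intr_int.
Qed.

Lemma strict_nonint x (f : int) : f%:~R < x < f%:~R + 1 -> x \isn't a Num.int.
Proof.
move=> /andP[fx xf]; apply/negP => /intrP[m em].
move: fx xf; rewrite em -[1]/(1%:~R) -intrD !ltr_int; lia.
Qed.

Definition fpart x := x - (Num.floor x)%:~R.

(** Lexicographic: the integer parts decide, and the fractional parts break a tie. *)
Lemma sub_le_int x y (c : int) : (x - y <= c%:~R) =
  (Num.floor x - Num.floor y < c) ||
  ((Num.floor x - Num.floor y == c) && (fpart x <= fpart y)).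
Proof.
rewrite /fpart.
have /andP[x1 x2] := floor_itv x; have /andP[y1 y2] := floor_itv y.
move: x1 x2 y1 y2; move: (Num.floor x) (Num.floor y) => f g; rewrite !intrD.
move=> x1 x2 y1 y2; case: (ltgtP (f - g) c) => [lt|gt|<-] /=.
- have : (f - g + 1)%:~R <= c%:~R :> R by rewrite ler_int; lia.
  by rewrite !rmorphD rmorphN /=; lra.
- have : (c + 1)%:~R <= (f - g)%:~R :> R by rewrite ler_int; lia.
  by rewrite !rmorphD rmorphN /= => ?; apply/negbTE; rewrite -ltNge; lra.
- by rewrite rmorphB /=; apply/idP/idP; lra.
Qed.

(** For each [s] an open interval just to the right of [A] contains no point congruent to [s];
    finitely many such intervals intersect in one. *)
Lemma avoid_int (S : seq R) (A B : R) : A < B ->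
  exists2 x, A < x < B & forall s, s \in S -> x - s \isn't a Num.int.
Proof.
move=> AB.
suff [C /andP[AC CB] h] : exists2 C, A < C <= B &
    forall x, A < x < C -> forall s, s \in S -> x - s \isn't a Num.int.
  have xC : A < (A + C) / 2 < C by apply/andP; split; lra.
  exists ((A + C) / 2); last exact: h.
  by case/andP: xC => -> h2; rewrite (lt_le_trans h2).
elim: S => [|s S [C /andP[AC CB] IH]]; first by exists B; rewrite // AB lexx.
have /andP[h1 h2] := floor_itv (A - s); rewrite intrD in h2.
pose D := (Num.floor (A - s))%:~R + 1 + s.
have AD : A < D by rewrite /D; lra.
exists (Num.min C D); first by rewrite lt_min AC AD ge_min CB.
move=> x /andP[Ax]; rewrite lt_min => /andP[xC xD] r.
rewrite inE => /predU1P[->|]; last by apply: IH; rewrite Ax xC.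
apply: (@strict_nonint _ (Num.floor (A - s))).
by apply/andP; split; move: xD; rewrite /D; lra.
Qed.

End IntegerParts.

Section OrderTypes.
Variables (R : realType) (n : nat).
Hypothesis n_gt0 : (0 < n)%N.
Implicit Types v : nat -> R.

Definition block v j i : R := v (j + i)%N.

Definition same_order m v v' := forall i l (c : int), (i < m)%N -> (l < m)%N ->
  (v i - v l <= c%:~R) = (v' i - v' l <= c%:~R).

Lemma same_order_sym m v v' : same_order m v v' -> same_order m v' v.
Proof. by move=> h i l c im lm; rewrite h. Qed.

Lemma same_order_floor m v v' i l : same_order m v v' -> (i < m)%N ->
  (l < m)%N -> Num.floor (v i - v l) = Num.floor (v' i - v' l).
Proof.
move=> h im lm.
suff H u u' : same_order m u u' ->
    Num.floor (u i - u l) <= Num.floor (u' i - u' l).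
  by apply/eqP; rewrite eq_le !H //; apply: same_order_sym.
move=> {h} h; rewrite floor_ge_int -lerN2 -rmorphN opprB -h // rmorphN.
by rewrite -[leLHS]opprB lerN2 floor_le.
Qed.

Lemma same_order_int m v v' i l : same_order m v v' -> (i < m)%N -> (l < m)%N ->
  (v i - v l \is a Num.int) = (v' i - v' l \is a Num.int).
Proof.
have intE x : (x \is a Num.int) = (x <= (Num.floor x)%:~R :> R).
  apply/idP/idP => [/floorK->//|h]; apply/intrP; exists (Num.floor x).
  by apply/eqP; rewrite eq_le h floor_le.
by move=> h im lm; rewrite !intE -(same_order_floor h) // h.
Qed.

Lemma same_order_fresh m v v' i : same_order m v v' -> (i < m)%N ->
  fresh v i = fresh v' i.
Proof.
move=> h im; apply: eq_forallb => l.
by rewrite (same_order_int h) //; apply: ltn_trans im.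
Qed.

Lemma same_order_tight (a : 'rV[int]_n.+1) v v' : same_order n.+1 v v' ->
  tight a v 0 -> tight a v' 0.
Proof.
move=> h.
suff H (i : 'I_n.+1) :
    (forall l : 'I_n.+1,
       v (0 + i)%N + (a 0 i)%:~R <= v (0 + l)%N + (a 0 l)%:~R) ->
    forall l : 'I_n.+1, v' (0 + i)%N + (a 0 i)%:~R <= v' (0 + l)%N + (a 0 l)%:~R.
  by move=> [i1 [i2 [i12 h1 h2]]]; exists i1, i2; split=> //; apply: H.
have E x y b c : (x + b%:~R <= y + c%:~R :> R) = (x - y <= (c - b)%:~R).
  by rewrite rmorphB /=; apply/idP/idP; lra.
by move=> im l; have := im l; rewrite !add0n !E (h i l) ?ltn_ord.
Qed.

(** If [v n] differs from some [v i] by an integer, the same shift of [v' i] works. Otherwise the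
    order type only asks for a point in an intersection of open unit intervals, which leaves room to
    avoid all classes of [S]. *)
Lemma same_order_extend v v' (S : seq R) : same_order n v v' ->
  exists2 x, same_order n.+1 v (upd v' n x) &
    fresh v n -> forall s, s \in S -> x - s \isn't a Num.int.
Proof.
move=> h.
suff [x hx xS] : exists2 x, forall i (c : int), (i < n)%N ->
      (v n - v i <= c%:~R) = (x - v' i <= c%:~R) /\
      (v i - v n <= c%:~R) = (v' i - x <= c%:~R) &
    fresh v n -> forall s, s \in S -> x - s \isn't a Num.int.
  exists x => // i l c; rewrite !ltnS => il ll.
  rewrite /upd; case: (eqVneq i n) il => [->|i_n] il;
    case: (eqVneq l n) ll => [->|ln] ll.
  - by rewrite !subrr.
  - by rewrite (hx l c _).1 // ltn_neqAle ln.
  - by rewrite (hx i c _).2 // ltn_neqAle i_n.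
  - by rewrite h // ltn_neqAle ?ln ?i_n.
have [fv|] := boolP (fresh v n); last first.
  move=> /forallPn[[i i_n]]; rewrite negbK /= => /intrP[m em].
  exists (v' i + m%:~R) => // l c ln.
  have -> : v n = v i + m%:~R by rewrite -em addrC subrK.
  have E1 u : (u i + m%:~R - u l <= c%:~R :> R) = (u i - u l <= (c - m)%:~R).
    by rewrite rmorphB /=; apply/idP/idP; lra.
  have E2 u : (u l - (u i + m%:~R) <= c%:~R :> R) = (u l - u i <= (c + m)%:~R).
    by rewrite rmorphD /=; apply/idP/idP; lra.
  by rewrite !E1 !E2 !h.
have fl i : (i < n)%N -> (Num.floor (v n - v i))%:~R < v n - v i <
    (Num.floor (v n - v i))%:~R + 1.
  by move=> i_n; apply: floor_strict; move/forallP: fv => /(_ (Ordinal i_n)).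
pose f i := Num.floor (v n - v i).
have [i _ imax] := arg_maxP (fun i : 'I_n => v' i + (f i)%:~R)
  (i0 := Ordinal n_gt0) (P := xpredT) isT.
have [l _ lmin] := arg_minP (fun i : 'I_n => v' i + (f i)%:~R)
  (i0 := Ordinal n_gt0) (P := xpredT) isT.
(* The corresponding intervals for [v] all contain [v n], hence meet pairwise; this is a comparison
   of a difference with an integer, so it carries over to [v']. *)
have AB : v' i + (f i)%:~R < v' l + (f l)%:~R + 1.
  have : ~~ (v l - v i <= (f i - f l - 1)%:~R).
    rewrite -ltNge !rmorphB /=.
    by have := fl i (ltn_ord i); have := fl l (ltn_ord l); rewrite /f; lra.
  by rewrite h // -ltNge !rmorphB /=; lra.
have [x /andP[x1 x2] xS] := avoid_int S AB.
exists x => // q c qn.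
have qx : (f q)%:~R < x - v' q < (f q)%:~R + 1.
  have := imax (Ordinal qn) isT; have := lmin (Ordinal qn) isT => /=.
  by move=> ? ?; apply/andP; split; lra.
split; first by rewrite (strict_int_le _ qx) (strict_int_le _ (fl q qn)).
by rewrite !(@strict_int_le _ _ (- f q - 1)) // !rmorphB rmorphN /=;
   have := fl q qn; rewrite -/(f q); lra.
Qed.

End OrderTypes.

(** * The graph of order types *)

Section WindowGraph.
Variables (R : realType) (n L : nat) (a : 'rV[int]_n.+1).
Hypothesis n_gt0 : (0 < n)%N.
Implicit Types v z : nat -> R.

Definition narrow v := forall i l, (i < n)%N -> (l < n)%N -> v i - v l <= L%:R.

(** For each entry: the shifted floor of its difference to entry 0, and the rank of the fractional
    part of that difference. *)
Definition order_type := {ffun 'I_n -> 'I_(2 * L).+1 * 'I_n.+1}.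

Definition floor0 v i : int := Num.floor (v i - v 0%N).

Definition frac_below v i : {set 'I_n} :=
  [set l : 'I_n | fpart (v l - v 0%N) < fpart (v i - v 0%N)].

(* [tau v] determines all comparisons of the differences of [v] with integers.
   For narrow [v] neither [inord] truncates: [- L <= floor0 v i <= L]. *)
Definition tau v : order_type :=
  [ffun i : 'I_n =>
     (inord (absz (floor0 v i + L%:Z)), inord #|frac_below v i|)].

Lemma sub_le_floor0 v i l (c : int) : (v i - v l <= c%:~R) =
  (floor0 v i - floor0 v l < c) ||
  ((floor0 v i - floor0 v l == c) &&
   (fpart (v i - v 0%N) <= fpart (v l - v 0%N))).
Proof. by rewrite -sub_le_int; congr (_ <= _); ring. Qed.

Lemma frac_below_le v (i l : 'I_n) :
  (#|frac_below v i| <= #|frac_below v l|)%N =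
  (fpart (v i - v 0%N) <= fpart (v l - v 0%N)).
Proof.
apply/idP/idP => [|il]; last first.
  apply: subset_leq_card; apply/fintype.subsetP => q; rewrite !inE => h.
  exact: lt_le_trans h il.
apply: contraLR; rewrite -ltNge -ltnNge => li.
apply: proper_card; apply/properP; split.
  apply/fintype.subsetP => q; rewrite !inE => h; exact: lt_trans h li.
by exists l; rewrite inE // ltxx.
Qed.

Lemma narrow_floor0 v (i : 'I_n) : narrow v ->
  [/\ 0 <= floor0 v i + L%:Z & floor0 v i + L%:Z <= 2 * L%:Z].
Proof.
move=> nv; have h1 := nv i 0%N (ltn_ord i) n_gt0.
have h2 := nv 0%N i n_gt0 (ltn_ord i).
have : - L%:Z <= floor0 v i by rewrite floor_ge_int rmorphN /=; lra.
suff : floor0 v i <= L%:Z by lia.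
by rewrite -(@ler_int R) (le_trans (floor_le _)).
Qed.

Lemma tau_same_order v v' : narrow v -> narrow v' -> tau v = tau v' ->
  same_order n v v'.
Proof.
move=> nv nv' /ffunP tvv'.
have fE (i : 'I_n) : floor0 v i = floor0 v' i.
  have := tvv' i; rewrite !ffunE => -[/(congr1 (@nat_of_ord _)) + _] /=.
  have [p1 p2] := narrow_floor0 i nv; have [q1 q2] := narrow_floor0 i nv'.
  rewrite !inordK; lia.
have rE (i : 'I_n) : #|frac_below v i| = #|frac_below v' i|.
  have := tvv' i; rewrite !ffunE => -[_ /(congr1 (@nat_of_ord _))] /=.
  by rewrite !inordK // ltnS -[leqRHS]card_ord max_card.
move=> i l c i_n ln.
rewrite !sub_le_floor0 (fE (Ordinal i_n)) (fE (Ordinal ln)).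
by rewrite -(frac_below_le v (Ordinal i_n) (Ordinal ln)) !rE frac_below_le.
Qed.

Lemma same_order_tau v v' : same_order n v v' -> tau v = tau v'.
Proof.
move=> h; apply/ffunP => i; rewrite !ffunE.
have fE (l : 'I_n) : floor0 v l = floor0 v' l by apply: same_order_floor h _ _.
rewrite fE; congr (_, inord #|pred_of_set _|).
apply/setP => l; rewrite !inE !ltNge; congr (~~ _).
have := h i l (floor0 v i - floor0 v l) (ltn_ord i) (ltn_ord l).
by rewrite !sub_le_floor0 !fE eqxx ltxx.
Qed.

Lemma same_order_narrow v v' : same_order n v v' -> narrow v -> narrow v'.
Proof.
by move=> h nv i l im lm; rewrite -[L%:R]/(L%:Z%:~R) -h //; apply: nv.
Qed.

Lemma same_order_block1 v v' : same_order n.+1 v v' ->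
  same_order n (block v 1) (block v' 1).
Proof. by move=> h i l c i_n ln; rewrite /block h. Qed.

Definition extends (x y : order_type) v :=
  [/\ narrow v, narrow (block v 1), tight a v 0, tau v = x &
    tau (block v 1) = y].

Definition edge : rel order_type := fun x y => `[< exists v, extends x y v >].

(** Freshness is tested only against the [n] preceding entries; [same_order_extend] can make it
    freshness against the whole past. *)
Definition edge_weight (x y : order_type) : bool :=
  `[< exists2 v, extends x y v & fresh v n >].

(** Independent of the chosen block, by [initial_tau]; order types of no narrow block get 0. *)
Definition initial (x : order_type) : nat :=
  if pselect (exists2 v, narrow v & tau v = x) is left h
  then nclasses (sval (cid2 h)) n else 0%N.

Lemma same_order_nclasses v v' :
  same_order n v v' -> nclasses v n = nclasses v' n.
Proof. by move=> h; apply: eq_bigr => l _; rewrite (same_order_fresh h). Qed.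

Lemma initial_tau v : narrow v -> initial (tau v) = nclasses v n.
Proof.
move=> nv; rewrite /initial; case: pselect => [h|[]]; last by exists v.
by case: cid2 => v' nv' /= /tau_same_order e; apply/same_order_nclasses/e.
Qed.

Lemma initial_le x : (initial x <= n)%N.
Proof.
rewrite /initial; case: pselect => // h; rewrite /nclasses.
rewrite -[leqRHS]card_ord -sum1_card; apply: leq_sum => l _; exact: leq_b1.
Qed.

Lemma fresh_ext v v' l :
  (forall i, (i <= l)%N -> v i = v' i) -> fresh v l = fresh v' l.
Proof. by move=> h; apply: eq_forallb => i; rewrite !h // ltnW. Qed.

Lemma nclassesS z k : nclasses z k.+1 = (nclasses z k + fresh z k)%N.
Proof. by rewrite /nclasses big_ord_recr. Qed.

Lemma weight_rcons x s y : weight edge_weight x (rcons s y) =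
  (weight edge_weight x s + edge_weight (last x s) y)%N.
Proof. by rewrite -cats1 weight_cat /= addn0. Qed.

Lemma walk_rcons x s y y' : walk edge x (rcons s y) y' =
  [&& walk edge x s (last x s), edge (last x s) y & y == y'].
Proof. by rewrite /walk rcons_path last_rcons eqxx andbT andbA. Qed.

(** A class that is new in the whole sequence is new in its window, so the weight of the walk can
    only overcount. *)
Lemma solution_walk K z : solution a (n + K) z -> block_bounded n L (n + K) z ->
  exists s, [/\ size s = K, walk edge (tau z) s (tau (block z K)) &
    (nclasses z (n + K) <= initial (tau z) + weight edge_weight (tau z) s)%N].
Proof.
elim: K => [|K IH] zs zb.
  exists [::]; split=> //; first by rewrite /walk /=; apply/eqP.
  rewrite !addn0 initial_tau // => i l i_n ln; apply: zb; lia.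
have [||s [sK ws le]] := IH.
- by move=> j jn; apply: zs; lia.
- by move=> l l' lk l'k; apply: zb; lia.
have ext : extends (tau (block z K)) (tau (block z K.+1)) (block z K).
  have b1 : block (block z K) 1 = block z K.+1.
    by apply/funext => i; rewrite /block addnA addn1.
  split=> //; rewrite ?b1 //.
  - by move=> i l i_n ln; apply: zb; lia.
  - by move=> i l i_n ln; apply: zb; lia.
  - by apply: zs; lia.
exists (rcons s (tau (block z K.+1))); split.
- by rewrite size_rcons sK.
- rewrite walk_rcons (walk_last ws) ws eqxx andbT /=.
  by apply/asboolP; exists (block z K).
- rewrite addnS nclassesS weight_rcons (walk_last ws) addnA leq_add //.
  case fz : (fresh z (n + K)) => //=; rewrite lt0b; apply/asboolP.
  exists (block z K) => //; apply/forallP => l.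
  move/forallP: fz => fz; have lK : (K + l < n + K)%N by have := ltn_ord l; lia.
  by have := fz (Ordinal lK); rewrite /block (addnC K n).
Qed.

(** The solution is built entry by entry: the last entry of a witness of each edge is transported to
    the current block, away from all earlier classes when the edge has weight 1. *)
Lemma walk_solution x s y :
  walk edge x s y -> (exists2 v, narrow v & tau v = x) ->
  exists z, [/\ solution a (n + size s) z, narrow (block z (size s)),
    tau (block z (size s)) = y &
    (initial x + weight edge_weight x s <= nclasses z (n + size s))%N].
Proof.
elim/last_ind: s y => [|s y IH] y'; rewrite ?walk_rcons.
  move=> /andP[_ /eqP <-] [v nv <-]; exists v; split=> //=.
  - by move=> j; lia.
  - by rewrite !addn0 initial_tau.
move=> /and3P[ws es /eqP <-] vx; have [z [zs zn zt le]] := IH _ ws vx.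
rewrite size_rcons weight_rcons; move: ws zs zn zt le.
set K := size s; set u := last x s in es * => ws zs zn zt le.
have [v ext fv] : exists2 v, extends u y v & edge_weight u y -> fresh v n.
  have [/asboolP[v vu vf]|_] := boolP (edge_weight u y); first by exists v.
  by move/asboolP: es => [v vu]; exists v.
have [vn vn1 vt tu ty] := ext.
have vz : same_order n v (block z K) by apply: tau_same_order; rewrite // tu.
have [x' ox' fx'] := same_order_extend n_gt0 [seq z l | l <- iota 0 (n + K)] vz.
pose z' := upd z (n + K) x'.
have bz' : upd (block z K) n x' = block z' K.
  by apply/funext => i; rewrite /block /z' /upd addnC eqn_add2r.
rewrite bz' in ox'.
have b1 : block (block z' K) 1 = block z' K.+1.
  by apply/funext => i; rewrite /block addnA addn1.
exists z'; split.
- move=> j jn; have [lt|ge] := ltnP (j + n) (n + K); first exact/tight_upd/zs.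
  have -> : j = K by lia.
  exact: same_order_tight ox' vt.
- by rewrite -b1; apply: same_order_narrow vn1; apply: same_order_block1.
- by rewrite -b1 -ty; apply/esym/same_order_tau/same_order_block1.
- rewrite addnS nclassesS addnA leq_add //.
    rewrite (leq_trans le) // leq_eqVlt; apply/orP; left; apply/eqP.
    apply: eq_bigr => l _; congr nat_of_bool; apply: fresh_ext => i il.
    by rewrite /z' upd_lt // (leq_ltn_trans il).
  case wuy : (edge_weight u y) => //=; rewrite lt0b; apply/forallP => l.
  have -> : z' l = z l by rewrite /z' upd_lt.
  have -> : z' (n + K)%N = x' by rewrite /z' /upd eqxx.
  apply: fx'; first exact: fv.
  by apply/mapP; exists (l : nat); rewrite // mem_iota /=.
Qed.

Lemma edge_realized x y : edge x y -> exists2 v, narrow v & tau v = x.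
Proof. by move=> /asboolP[v [nv _ _ tv _]]; exists v. Qed.

End WindowGraph.

(** * Quasi-linearity *)

Lemma nclasses_congr (R : realType) (z z' : nat -> R) k :
  (forall l, z' l - z l \is a Num.int) -> nclasses z' k = nclasses z k.
Proof.
move=> zz'; apply: eq_bigr => l _; congr nat_of_bool; apply: eq_forallb => i.
have -> : z' l - z' i = (z l - z i) + ((z' l - z l) - (z' i - z i)) by ring.
by rewrite [_ + (_ - _)]addrC rpredDl // rpredB.
Qed.

(** Vertices are blocks of [n] entries, so walks of length [K] match solutions of length [n + K];
    this shift contributes [A * n] to both sides and cancels. *)
Lemma trop_hilbert_periodic (R : realType) (n M X : nat) (a : 'rV[int]_n.+1)
    (alpha : int) : (0 < n)%N -> (0 < M)%N ->
  (forall i, alpha <= a 0 i <= alpha + M%:Z) ->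
  let N := (((2 * (5 * n * M)).+1 * n.+1) ^ n)%N in
  let d := trop_hilbert (map_mx intr a : 'rV[R]_n.+1) in
  (N <= X ^ 2)%N ->
  exists A B p, [/\ (0 < B)%N, (0 < p)%N, (p <= X ^ (3 * X))%N &
    forall k K, (7 * N ^ 3 <= k)%N -> (7 * N ^ 3 <= K)%N -> k = K %[mod p] ->
      (B * d k + A * K = B * d K + A * k)%N].
Proof.
move=> n0 M0 aM N d NX; pose L := (5 * n * M)%N.
pose T := order_type n L.
have cT : #|T| = N by rewrite card_ffun card_prod !card_ord.
have f_ge (x : T) s y : (0 < size s)%N -> walk (edge R a) x s y ->
    (initial R x + weight (edge_weight R a) x s <= d (n + size s)%N)%N.
  case: s => // x' s _ ws.
  have [|z [zs _ _ le]] := walk_solution n0 ws.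
    by apply: (@edge_realized R n L a x x'); case/andP: ws => /= /andP[].
  exact: leq_trans le (nclasses_le zs).
have f_le K : exists (x : T) s y, [/\ size s = K, walk (edge R a) x s y &
    (d (n + K)%N <= initial R x + weight (edge_weight R a) x s)%N].
  have [z zs dz] := nclasses_attained R a n0 (n + K).
  have [z' [zs' zz' zb']] := solution_clamp n0 aM M0 (leq_addr _ _) zs.
  have [s [sK ws le]] := solution_walk n0 zs' zb'.
  exists (tau n L z'), s, (tau n L (block z' K)); split=> //.
  by apply: leq_trans le; rewrite (nclasses_congr _ zz').
have := optimal_walk_periodic (f := fun K => d (n + K)%N) (@initial_le R n L)
  _ f_ge f_le.
rewrite cT => /(_ X NX)[A [B [p [B0 p0 pX per]]]].
exists A, B, p; split=> //.
have nN : (n < N)%N.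
  apply: (@leq_trans (n.+1 ^ n)%N).
    by apply: leq_trans (leq_pexp2l _ n0); rewrite ?expn1.
  by rewrite leq_exp2r // leq_pmull.
set thr := (2 * N ^ 3 + _ + N + 2 * N ^ 2 + 1)%N in per.
(* Here the initial reward is at most [G = n < N], and lower powers of [N] are absorbed into
   [N ^ 3]. *)
have thrN : (n + thr <= 7 * N ^ 3)%N.
  have h1 : (N ^ 2 * n <= N ^ 3)%N by rewrite (expnSr N 2) leq_mul // ltnW.
  have N0 : (0 < N)%N by lia.
  have h2 : (N ^ 2 <= N ^ 3)%N by rewrite leq_pexp2l.
  have h3 : (N <= N ^ 3)%N by rewrite -{1}(expn1 N) leq_pexp2l.
  by rewrite /thr; lia.
move=> k K kN KN kK.
have kn : (n <= k)%N.
  by apply: leq_trans kN; apply: leq_trans thrN; rewrite leq_addr.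
have Kn : (n <= K)%N.
  by apply: leq_trans KN; apply: leq_trans thrN; rewrite leq_addr.
have := per (k - n)%N (K - n)%N; rewrite !subnKC // !mulnBr => h.
have {h} : (B * d k + (A * K - A * n) = B * d K + (A * k - A * n))%N.
  apply: h; [lia|lia|].
  by apply/eqP; rewrite -(eqn_modDl n) !subnKC // kK.
have : (A * n <= A * k)%N by rewrite leq_mul2l kn orbT.
have : (A * n <= A * K)%N by rewrite leq_mul2l Kn orbT.
lia.
Qed.

(** A periodic [r] is bounded, so [r k / k] tends to 0; this identifies the slope with the
    entropy. *)
Lemma lim_quasi_linear (R : realType) (d : nat -> nat) (h : R) (r : nat -> R)
    (p k0 : nat) : (0 < p)%N -> (forall k, r (k + p)%N = r k) ->
  (forall k, (k0 < k)%N -> (d k)%:R = h * k%:R + r k) ->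
  limn (fun k => (d k)%:R / k%:R : R) = h.
Proof.
move=> p0 rp dE.
pose C := \sum_(i < p) `|r i|.
have rC k : `|r k| <= C.
  have -> : r k = r (k %% p)%N.
    rewrite {1}(divn_eq k p) addnC; elim: (k %/ p)%N => [|q IH].
      by rewrite mul0n addn0.
    by rewrite mulSnr addnA rp.
  rewrite /C (bigD1 (Ordinal (ltn_pmod k p0))) //= lerDl.
  by rewrite sumr_ge0.
apply/cvg_lim => //; apply/cvgrPdist_le => e e0.
near=> k.
have kk0 : (k0 < k)%N by near: k; exact: nbhs_infty_gt.
have kC : C / e <= k%:R by near: k; exact: nbhs_infty_ger.
have k_gt0 : 0 < k%:R :> R by rewrite ltr0n; lia.
rewrite dE // mulrDl mulfK ?gt_eqF // opprD addrA subrr sub0r normrN.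
rewrite normrM normfV (ger0_norm (ltW k_gt0)) ler_pdivrMr //.
by rewrite (le_trans (rC k)) // mulrC -ler_pdivrMr.
Unshelve. all: by end_near.
Qed.

(** Both entries of a window of length two must attain its minimum, so consecutive entries are
    congruent and only one class occurs. *)
Lemma trop_hilbert_order1 (R : realType) (a : 'rV[int]_2) k : (0 < k)%N ->
  trop_hilbert (map_mx intr a : 'rV[R]_2) k = 1%N.
Proof.
move=> k0.
have cls (z : nat -> R) : solution a k z -> nclasses z k = 1%N.
  move=> zs; rewrite /nclasses (bigD1 (Ordinal k0)) //= big1 ?addn0 => [|l l0].
    by rewrite (_ : fresh _ _ = true) //; apply/forallP => -[].
  have {}l0 : (0 < l)%N.
    by rewrite lt0n; apply: contra l0 => /eqP l0; apply/eqP/val_inj.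
  have [|i1 [i2 [i12 h1 h2]]] := zs l.-1; first by have := ltn_ord l; lia.
  apply/eqP; rewrite eqb0; apply/negP => /forallP.
  have ll : (l.-1 < l)%N by lia.
  move=> /(_ (Ordinal ll))/negP; apply => /=.
  have H (i j : 'I_2) : (i < j)%N -> z (l.-1 + i)%N + (a 0 i)%:~R =
      z (l.-1 + j)%N + (a 0 j)%:~R -> z l - z l.-1 \is a Num.int.
    move=> ij; have -> : (i = 0 :> nat)%N by have := ltn_ord j; lia.
    have -> : (j = 1 :> nat)%N by have := ltn_ord j; lia.
    rewrite addn0 addn1 prednK // => e.
    have -> : z l - z l.-1 = (a 0 i - a 0 j)%:~R by rewrite rmorphB /=; lra.
    exact: intr_int.
  have e : z (l.-1 + i1)%N + (a 0 i1)%:~R = z (l.-1 + i2)%N + (a 0 i2)%:~R.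
    by apply/eqP; rewrite eq_le h1 h2.
  case: (ltngtP i1 i2) => [lt|gt|/val_inj/eqP]; last by rewrite (negbTE i12).
    exact: H lt e.
  exact: H gt (esym e).
apply/eqP; rewrite eqn_leq; apply/andP; split.
  by have [z zs] := nclasses_attained R a isT k; rewrite (cls z zs).
have [z zs] := solution_exists R a isT k.
by have := nclasses_le zs; rewrite (cls z zs).
Qed.

(** * Explicit bounds on period and threshold *)

Lemma nat_sqrt_approx M : (0 < M)%N -> exists m, (M <= m ^ 2 <= 4 * M)%N.
Proof.
move=> M0; have exm : exists m, (M <= m ^ 2)%N.
  by exists M; rewrite -mulnn leq_pmulr.
case: (ex_minnP exm) => m Mm mmin; exists m; rewrite Mm /=.
have [m1|m1] := leqP m 1; first by move: Mm; case: m m1 {mmin} => [|[]]//; lia.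
have : ~~ (M <= m.-1 ^ 2)%N by apply/negP => /mmin; lia.
rewrite -!mulnn; nia.
Qed.

(** With [y = 5 * n * m], the bound [X ^ (3 * X)] equals [y ^ (3 * n * X)], and [y <= expR y] turns
    it into an exponential. *)
Lemma period_bound (R : realType) (n m M X p : nat) : (0 < n)%N -> (0 < M)%N ->
  (M <= m ^ 2 <= 4 * M)%N -> X = ((5 * n * m) ^ n)%N -> (p <= X ^ (3 * X))%N ->
  p%:R < expR ((1200 * (M * n))%:R ^+ n) :> R.
Proof.
move=> n0 M0 /andP[Mm mM] XE pX; pose y := (5 * n * m)%N.
have m0 : (0 < m)%N by case: m Mm {mM XE y} => //; rewrite leqNgt M0.
(* [1200 = 15 * 4 * 5 * 4]: the left side is [15 * n ^ 2 * m * X], with [15 <= 15 ^ n],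
   [n ^ 2 < 4 ^ n], [m <= m ^ n] and [X = (5 * n * m) ^ n]; the last 4 comes from
   [m ^ 2 <= 4 * M]. *)
have lt : (3 * n * X * y < (1200 * (M * n)) ^ n)%N.
  have nn : (n ^ 2 < 4 ^ n)%N.
    by rewrite (_ : 4 = 2 ^ 2)%N // -expnM mulnC expnM ltn_exp2r // ltn_expl.
  have mm : (m <= m ^ n)%N by rewrite -{1}(expn1 m) leq_pexp2l.
  have c15 : (15 <= 15 ^ n)%N by rewrite -{1}(expn1 15) leq_pexp2l.
  apply: (@leq_trans (((15 * 4 * 5) * (m * (n * m))) ^ n)%N); last first.
    rewrite leq_exp2r //.
    apply: (@leq_trans (300 * (n * m ^ 2))%N); first by rewrite -mulnn; lia.
    apply: (@leq_trans (300 * (n * (4 * M)))%N); last lia.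
    by rewrite !leq_mul2l mM !orbT.
  have -> : (3 * n * X * y = 15 * n ^ 2 * (m * X))%N.
    by rewrite /y -mulnn; move: (X); lia.
  have -> : (((15 * 4 * 5) * (m * (n * m))) ^ n =
             15 ^ n * 4 ^ n * (m ^ n * X))%N.
    by rewrite XE -!expnMn; congr (_ ^ _)%N; lia.
  have X0 : (0 < X)%N by rewrite XE expn_gt0; apply/orP; left; lia.
  apply: (@leq_trans (15 * 4 ^ n * (m * X))%N).
    by rewrite ltn_pmul2r ?ltn_pmul2l // muln_gt0 m0.
  by rewrite !leq_mul.
apply: (@le_lt_trans _ _ ((X ^ (3 * X))%:R)); first by rewrite ler_nat.
have -> : (X ^ (3 * X) = y ^ (3 * n * X))%N.
  by rewrite {1}XE -expnM; congr (_ ^ _)%N; lia.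
rewrite -natrX in lt *.
apply: (@le_lt_trans _ _ (expR (3 * n * X * y)%:R)); last first.
  by rewrite ltr_expR ltr_nat.
rewrite natrM expRM_natl natrX lerXn2r ?nnegrE ?expR_ge0 //.
by apply: le_trans (expR_ge1Dx _); rewrite lerDr.
Qed.

(** Since [u = M * n] is at least 2, constants become powers of [u]: the factor 7 is below
    [u ^ (3 * n)] and the base is below [u ^ 7], and [3 * n + 21 * n = 24 * n]. *)
Lemma threshold_bound n M : (1 < n)%N -> (0 < M)%N ->
  (7 * (((2 * (5 * n * M)).+1 * n.+1) ^ n) ^ 3 <= (M * n) ^ (24 * n))%N.
Proof.
move=> n1 M0; set u := (M * n)%N.
have u2 : (2 <= u)%N by rewrite /u; nia.
have u7 : ((2 * (5 * n * M)).+1 * n.+1 <= u ^ 7)%N.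
  apply: (@leq_trans (2 ^ 5 * u ^ 2)%N).
    rewrite -mulnn /u; nia.
  by rewrite (_ : 7 = 5 + 2)%N // expnD leq_mul // leq_exp2r.
apply: (@leq_trans (u ^ (3 * n) * ((u ^ 7) ^ n) ^ 3)%N).
  apply: leq_mul; last by rewrite !leq_exp2r //; lia.
  rewrite expnM; apply: (@leq_trans ((u ^ 3) ^ 1)%N).
    by rewrite expn1; apply: (@leq_trans (2 ^ 3)%N) => //; rewrite leq_exp2r.
  by rewrite leq_pexp2l ?expn_gt0; lia.
by rewrite -!expnM -expnD; apply: eq_leq; congr (_ ^ _)%N; lia.
Qed.

Lemma amplitude_bounds n (a : 'rV[int]_n.+1) : exists alpha : int,
  forall i, alpha <= a 0 i <= alpha + (amplitude a)%:Z.
Proof.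
exists (\big[Num.min/a 0 ord0]_i a 0 i) => i.
have h1 : \big[Num.min/a 0 ord0]_i a 0 i <= a 0 i by apply: bigmin_le.
have h2 : a 0 i <= \big[Num.max/a 0 ord0]_i a 0 i by apply: le_bigmax.
by rewrite h1 /amplitude; lia.
Qed.

(* The constants implied by the two O's are C1 and C2; they depend neither on
   n nor on a.  For a constant vector (amplitude 0) the bounds only make sense
   with the amplitude replaced by 1, since no period is less than exp(0). *)
Theorem corollary5p5 (R : realType) :
  exists C1 C2 : nat,
    forall (n : nat) (a : 'rV[int]_n.+1), (0 < n)%N ->
      let M := maxn 1 (amplitude a) in
      let aR : 'rV[R]_n.+1 := map_mx intr a in
      let d := trop_hilbert aR in
      let H := trop_entropy aR in
      exists (r : nat -> R) (p : nat),
        [/\ (0 < p)%N,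
            p%:R < expR ((C2 * (M * n))%:R ^+ n) :> R,
            (forall k : nat, r (k + p)%N = r k)
          & forall k : nat, ((M * n) ^ (C1 * n) < k)%N ->
              (d k)%:R = H * k%:R + r k].
Proof.
exists 24%N, 1200%N => n a n0 M aR d H.
have M0 : (0 < M)%N by rewrite leq_maxl.
(* For [n = 1] and [M = 1] the power [(M * n) ^ (C1 * n)] is 1 and absorbs no constant, so this case
   is computed directly. *)
have [n1|n1] := leqP n 1.
  have {n0 n1} n1 : n = 1%N by lia.
  subst n; exists (fun=> 1), 1%N.
  have d1 k : (0 < k)%N -> (d k)%:R = 0 * k%:R + 1 :> R.
    by move=> k0; rewrite /d trop_hilbert_order1 // mul0r add0r.
  have H0 : H = 0.
    exact: (@lim_quasi_linear R d 0 (fun=> 1) 1 0 isT (fun=> erefl) d1).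
  split=> //; last first.
    by move=> k k1; rewrite H0; apply: d1; apply: leq_ltn_trans k1.
  by rewrite -[ltLHS]expR0 ltr_expR expr1 ltr0n; lia.
have [alpha aM'] := amplitude_bounds a.
have aM i : alpha <= a 0 i <= alpha + M%:Z.
  by have := aM' i; have := leq_maxr 1 (amplitude a); rewrite -/M; lia.
have [m mM] := nat_sqrt_approx M0.
(* The factor 5 makes [25 * n ^ 2 * M] dominate the base of [N] once [n] is at least 2, and [m ^ 2]
   replaces [M] to get a square. *)
pose X := ((5 * n * m) ^ n)%N.
have NX : (((2 * (5 * n * M)).+1 * n.+1) ^ n <= X ^ 2)%N.
  rewrite /X expnAC leq_exp2r //.
  case/andP: mM => Mm _; apply: (@leq_trans (25 * n ^ 2 * M)%N).
    by rewrite -mulnn; nia.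
  apply: (@leq_trans (25 * n ^ 2 * m ^ 2)%N); first by rewrite leq_mul.
  by rewrite !expnMn.
have [A [B [p [B0 p0 pX per]]]] := trop_hilbert_periodic R n0 M0 aM NX.
have thr := threshold_bound n1 M0; set N := (_ ^ n)%N in per thr.
pose Q := (7 * N ^ 3)%N; pose h : R := A%:R / B%:R.
(* The shift by [Q * p] keeps the residue modulo [p] and passes the threshold, so [r] is periodic
   from 0 on. *)
pose r k : R := (d (k + Q * p)%N)%:R - h * (k + Q * p)%:R.
have BR : B%:R != 0 :> R by rewrite pnatr_eq0 -lt0n.
have Bh : B%:R * h = A%:R by rewrite /h mulrC divfK.
have dd k K : (Q <= k)%N -> (Q <= K)%N -> k = K %[mod p] ->
    (d k)%:R - h * k%:R = (d K)%:R - h * K%:R.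
  move=> kQ KQ kK; have /(congr1 (fun x => x%:R : R)) := per k K kQ KQ kK.
  rewrite !natrD !natrM => e; apply: (mulfI BR).
  by rewrite !mulrBr !(mulrA _ h) Bh; lra.
have QQ k : (Q <= k + Q * p)%N.
  by rewrite (leq_trans (leq_pmulr Q p0)) ?leq_addl.
have rp k : r (k + p)%N = r k.
  by apply: dd => //; rewrite addnAC modnDr.
have dr k : (Q <= k)%N -> (d k)%:R = h * k%:R + r k.
  move=> kQ; rewrite /r -(dd k) //; first by rewrite addrC subrK.
  by rewrite addnC modnMDl.
have HE : H = h.
  by apply: (lim_quasi_linear (k0 := Q) p0 rp) => k kQ; apply: dr; apply: ltnW.
exists r, p; split=> //.
- exact: period_bound mM erefl pX.
- by move=> k kM; rewrite HE; apply: dr; apply: leq_trans thr (ltnW kM).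
Qed.
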